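(* Let $\sigma>0$ and $k\ge0$. For all $L\in\mathbb N$, $L\ge2$, the ABEP$(\sigma,k)$ on $\mathbb R_+^L$ with closed boundary conditions admits a family (labeled by $\gamma>-4\sigma k$) of reversible product measures with marginals given by (the densities) $$\mu_i(x_i)=\frac1{\mathcal Z_i^{(\gamma)}}\,(1-e^{-2\sigma x_i})^{2k-1}e^{-(4\sigma ki+\gamma)x_i},\qquad x_i\in\mathbb R_+,$$ for $i\in\{1,\dots,L\}$, where $$\mathcal Z_i^{(\gamma)}=\frac1{2\sigma}\,\mathrm{Beta}\Big(2ki+\frac\gamma{2\sigma},\,2k\Big).$$
   Context: $\mathbb R_+=[0,\infty)$ and $\mathrm{Beta}(a,b)=\int_0^1u^{a-1}(1-u)^{b-1}du$ is the Beta function. The ABEP$(\sigma,k)$ (asymmetric Brownian energy process) with closed boundary conditions is the Markov process on $\mathbb R_+^L$ whose generator acts on the core of smooth functions $f:\mathbb R_+^L\to\mathbb R$ as $\sum_{i=1}^{L-1}\mathcal L_{i,i+1}$, where $$\mathcal L_{i,i+1}f(x)=\tfrac1{4\sigma^2}(1-e^{-2\sigma x_i})(e^{2\sigma x_{i+1}}-1)\Big(\tfrac{\partial}{\partial x_i}-\tfrac{\partial}{\partial x_{i+1}}\Big)^2f(x)-\tfrac1{2\sigma}\Big\{(1-e^{-2\sigma x_i})(e^{2\sigma x_{i+1}}-1)+2k\big(2-e^{-2\sigma x_i}-e^{2\sigma x_{i+1}}\big)\Big\}\Big(\tfrac{\partial}{\partial x_i}-\tfrac{\partial}{\partial x_{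i+1}}\Big)f(x).$$
   Formalization: For k=0 the Beta function is infinite and the density is undefined; the formal statement then reads 1/Z_i as 0, so the measure is zero, and it asserts that the marginals and the product measure have total mass 1 only for k>0. *)

(* Defs.v *)
From HB Require Import structures.
From mathcomp Require Import all_boot all_order all_algebra.
From mathcomp Require Import all_classical all_reals all_analysis.

Set Implicit Arguments.
Unset Strict Implicit.
Unset Printing Implicit Defensive.

Import Order.TTheory GRing.Theory Num.Theory.
Import numFieldNormedType.Exports.

Local Open Scope classical_set_scope.
Local Open Scope ring_scope.

Definition orthant (R : realType) (L : nat) : set 'rV[R]_L :=
  [set x | forall i, 0 <= x ord0 i].

(* R_+^L with the topology induced by R^L and its Borel sigma-algebra *)
Definition state (R : realType) (L : nat) : Type := set_type (@orthant R L).

Lemma orthant0 (R : realType) (L : nat) : (0 : 'rV[R]_L) \in @orthant R L.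
Proof. by rewrite inE => i; rewrite mxE. Qed.

HB.instance Definition _ (R : realType) (L : nat) :=
  Topological.copy (state R L) (set_type (@orthant R L)).
HB.instance Definition _ (R : realType) (L : nat) :=
  isPointed.Build (state R L) (exist _ 0 (orthant0 R L)).
HB.instance Definition _ (R : realType) (L : nat) :=
  Measurable.copy (state R L) (g_sigma_algebraType (@open (state R L))).

Definition row_of (R : realType) (L : nat) (x : state R L) : 'rV[R]_L := \val x.

Section smooth_functions.
Context (R : realType) (L : nat).
Implicit Types (F : 'rV[R]_L -> R) (f : state R L -> R).

Definition partial (i : 'I_L) F : 'rV[R]_L -> R := 'D_(delta_mx ord0 i) F.

Definition smooth F : Prop :=
  forall (s : seq 'I_L) (x : 'rV[R]_L), differentiable (foldr partial F s) x.

(* Smooth functions on the closed orthant are restrictions of smooth functions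
   on R^L; by continuity the derivatives of F at boundary points of the orthant
   depend only on the restriction of F. *)
Definition test_function F : Prop :=
  smooth F /\
  exists2 K : set (state R L), compact K & forall x, ~ K x -> F (row_of x) = 0.

Definition C0 f : Prop :=
  continuous f /\
  forall e : R, 0 < e ->
    exists2 K : set (state R L), compact K & forall x, ~ K x -> `|f x| < e.

End smooth_functions.

Section markov.
Context (R : realType) (L : nat) (P : R -> R.-pker (state R L) ~> (state R L)).
Implicit Types f g : state R L -> R.

(* P is only meaningful at nonnegative times. *)
Definition markov_semigroup : Prop :=
  (forall x (A : set (state R L)), measurable A -> P 0 x A = (\d_x A)%E) /\
  (forall s t : R, 0 <= s -> 0 <= t ->
     forall x (A : set (state R L)), measurable A ->
       P (s + t) x A = (\int[P s x]_y P t y A)%E).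

Definition semigroup_op (t : R) f : state R L -> R :=
  fun x => \int[P t x]_y f y.

Definition feller : Prop :=
  (forall (t : R) f, 0 <= t -> C0 f -> C0 (semigroup_op t f)) /\
  (forall f, C0 f -> forall e : R, 0 < e ->
     \forall t \near 0^'+, forall x, `|semigroup_op t f x - f x| < e).

(* the graph of the infinitesimal generator on C_0(R_+^L) *)
Definition generator f g : Prop :=
  [/\ C0 f, C0 g &
    forall e : R, 0 < e -> \forall t \near 0^'+,
      forall x, `|t^-1 * (semigroup_op t f x - f x) - g x| < e].

Definition reversible (mu : {measure set (state R L) -> \bar R}) : Prop :=
  forall t : R, 0 <= t ->
    forall A B : set (state R L), measurable A -> measurable B ->
      (\int[mu]_(x in A) P t x B = \int[mu]_(x in B) P t x A)%E.

End markov.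

Section abep.
Context (R : realType) (sigma k : R) (L : nat).
Implicit Types (F : 'rV[R]_L -> R) (x : 'rV[R]_L).

Definition grad_diff (i j : 'I_L) F : 'rV[R]_L -> R :=
  fun x => partial i F x - partial j F x.

Definition abep_bond (i j : 'I_L) F x : R :=
  let xi := x ord0 i in
  let xj := x ord0 j in
  (4 * sigma ^+ 2)^-1
    * (1 - expR (- (2 * sigma * xi))) * (expR (2 * sigma * xj) - 1)
    * grad_diff i j (grad_diff i j F) x
  - (2 * sigma)^-1
    * ((1 - expR (- (2 * sigma * xi))) * (expR (2 * sigma * xj) - 1)
       + 2 * k * (2 - expR (- (2 * sigma * xi)) - expR (2 * sigma * xj)))
    * grad_diff i j F x.

Definition abep_generator F x : R :=
  \sum_(i < L) \sum_(j < L | j == i.+1 :> nat) abep_bond i j F x.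

(* The process is represented by its transition kernels. The last clause says
   that the test functions form a core: the generator is the closure of its
   restriction to them. *)
Definition is_abep (P : R -> R.-pker (state R L) ~> (state R L)) : Prop :=
  [/\ markov_semigroup P, feller P,
    (forall F, test_function F ->
       generator P (F \o @row_of R L) (abep_generator F \o @row_of R L)) &
    (forall f g, generator P f g -> forall e : R, 0 < e ->
       exists F, [/\ test_function F,
         (forall x : state R L, `|f x - F (row_of x)| < e) &
         (forall x : state R L, `|g x - abep_generator F (row_of x)| < e)])].

End abep.

Section product_measures.
Context (R : realType).

(* Extended-real valued: +oo when a <= 0 or b <= 0. *)
Definition Beta (a b : R) : \bar R :=
  (\int[lebesgue_measure]_(u in `]0%R, 1%R[)
     ((u `^ (a - 1) * (1 - u) `^ (b - 1))%R)%:E)%E.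

Definition abep_Z (sigma k gamma : R) (i : nat) : \bar R :=
  (((2 * sigma)^-1)%R%:E
     * Beta (2 * k * i%:R + gamma / (2 * sigma))%R (2 * k)%R)%E.

Definition abep_weight (sigma k gamma : R) (i : nat) (x : R) : R :=
  (1 - expR (- (2 * sigma * x))) `^ (2 * k - 1)
    * expR (- ((4 * sigma * k * i%:R + gamma) * x)).

(* Since +oo^-1 = 0 in \bar R, the density vanishes when abep_Z is infinite,
   which happens exactly for k = 0 in the range of parameters considered. *)
Definition abep_density (sigma k gamma : R) (i : nat) (x : R) : \bar R :=
  ((abep_Z sigma k gamma i)^-1 * (abep_weight sigma k gamma i x)%:E)%E.

Definition abep_marginal (sigma k gamma : R) (i : nat) (A : set R) : \bar R :=
  (\int[lebesgue_measure]_(x in A `&` `[0%R, +oo[)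
     abep_density sigma k gamma i x)%E.

Definition is_product_measure (L : nat)
    (mu : {measure set (state R L) -> \bar R})
    (nu : 'I_L -> set R -> \bar R) : Prop :=
  forall A : 'I_L -> set R, (forall i, measurable (A i)) ->
    mu [set x | forall i, A i (row_of x ord0 i)] = (\prod_(i < L) nu i (A i))%E.

End product_measures.

(* Main.v *)
(* Let [k > 0], let [rho] be the product density, fix a bond [(i, i+1)] and put
   [d = d_i - d_j] and [V = G dF - F dG].  The antisymmetrised bond generator
   [G L F - F L G] equals [rho^-1 d(a rho V)], [a] being the diffusion
   coefficient, and [a rho] vanishes on the boundary.  Integrating by parts in
   one coordinate at a time (resampling one coordinate preserves a product
   measure) shows that the generator is symmetric on test functions, hence
   everywhere since these form a core.  Then [s |-> <P_s f, P_(t-s) g>] varies by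
   [o(h)] over time steps [h], uniformly in [s], so it is constant and the
   semigroup is symmetric.  Reversibility follows by approximating indicators of
   open boxes by smooth bumps.  For [k = 0] the partition functions are infinite
   and the measure is zero. *)
Require Import Defs.
From HB Require Import structures.
From mathcomp Require Import all_boot all_order all_algebra.
From mathcomp Require Import all_classical all_reals all_analysis.
From mathcomp Require Import measurable_realfun.
From mathcomp Require Import ring lra.

Import Order.TTheory GRing.Theory Num.Theory.
Import numFieldNormedType.Exports.

Set Implicit Arguments.
Unset Strict Implicit.
Unset Printing Implicit Defensive.

Local Open Scope classical_set_scope.
Local Open Scope ring_scope.

(** * The state space and its Borel sets *)

(** Write alpha(x) = 1 - e^(-tau x) with tau = 2 sigma. The diffusion coefficient of a bond is
    alpha(x_i) (e^(tau x_j) - 1), up to a constant, and e^(tau x_j) - 1 = e^(tau x_j) alpha(x_j), so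
    each coordinate brings its own zero at its own face. This matters when 2k < 1: the density is
    then unbounded at 0, while alpha times the density behaves like alpha^(2k) and still vanishes
    there. The calculus is therefore done on segments inside the open half-line and passed to the
    limit. The growth of the rates c_i = 4 sigma k i + gamma is dictated by the drift: the V-terms
    coming from the two sites add up to the drift of the bond exactly because c_(i+1) - c_i = 4
    sigma k. The derivatives in x_i and x_j are integrated separately, so only one-dimensional
    integrals against a marginal occur, and the measure on the orthant enters through its values on
    products of sets. The generator is a uniform right-hand limit on C_0, so the time argument uses
    forward increments only. *)

Section state_space.
Context (R : realType) (L : nat).
Local Notation S := (state R L).
Implicit Types (x y : S) (a b : 'I_L -> R).

Lemma row_of_ge0 x i : 0 <= row_of x ord0 i.
Proof. by case: x => v /= vo; exact: (set_mem vo). Qed.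

Lemma orthant_pos_part (v : 'rV[R]_L) :
  \row_i Num.max (v ord0 i) 0 \in @orthant R L.
Proof. by rewrite inE => i; rewrite mxE le_max lexx orbT. Qed.

(** The positive part is a continuous retraction of the whole space onto the orthant: a map into
    [state R L] can be given by an arbitrary row. The clamp is invisible to measures carried by the
    half-line. *)
Definition state_of (v : 'rV[R]_L) : S :=
  exist _ (\row_i Num.max (v ord0 i) 0) (orthant_pos_part v).

Lemma row_of_state_of v i : row_of (state_of v) ord0 i = Num.max (v ord0 i) 0.
Proof. by rewrite /row_of/= mxE. Qed.

Lemma state_ofK (v : 'rV[R]_L) : (forall i, 0 <= v ord0 i) ->
  row_of (state_of v) = v.
Proof. by move=> v0; apply/rowP => i; rewrite row_of_state_of; apply/max_idPl. Qed.

Lemma row_ofK x : state_of (row_of x) = x.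
Proof. by apply: val_inj; apply: state_ofK => i; exact: row_of_ge0. Qed.

Lemma continuous_row_of : continuous (@row_of R L).
Proof. exact: initial_continuous. Qed.

Lemma continuous_coord_state i : continuous (fun x => row_of x ord0 i).
Proof.
move=> x; apply: (@continuous_comp _ _ _ (@row_of R L) (fun v => v ord0 i)).
  exact: continuous_row_of.
exact: coord_continuous.
Qed.

Lemma continuous_to_state (X : topologicalType) (f : X -> S) :
  (forall i, continuous (fun z => row_of (f z) ord0 i)) -> continuous f.
Proof.
move=> cf; apply: continuous_comp_initial => z A -[P Pz PA] /=.
have : \forall u \near z, forall i, P ord0 i (row_of (f u) ord0 i).
  by apply: filter_forall => i; apply: cf; exact: Pz.
by apply: filterS => u Pu; apply: PA => k i; rewrite (ord1 k); exact: Pu.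
Qed.

Lemma continuous_state_of : continuous state_of.
Proof.
apply: continuous_to_state => i v.
rewrite (_ : (fun z => _) = (fun z : 'rV_L => z ord0 i) \max cst 0); last first.
  by apply/funext => z; rewrite row_of_state_of.
by apply: continuous_max; [exact: coord_continuous|exact: cst_continuous].
Qed.

Definition obox a b : set S := [set x | forall i, a i < row_of x ord0 i < b i].
Definition oboxes : set (set S) := [set A | exists a b, A = obox a b].

Lemma open_obox a b : open (obox a b).
Proof.
rewrite openE => x xab.
suff : \forall y \near x, forall i, a i < row_of y ord0 i < b i by [].
apply: (@filter_forall _ _ _ (nbhs x) (nbhs_filter x)) => i.
have /andP[ax xb] := xab i.
have /(_ `]a i, b i[%classic) cx := @continuous_coord_state i x.
by apply: cx; apply: near_in_itvoo; rewrite in_itv/= ax xb.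
Qed.

Lemma measurable_open_state (U : set S) : open U -> measurable U.
Proof. by move=> oU; exact: sub_sigma_algebra. Qed.

Lemma measurable_obox a b : measurable (obox a b).
Proof. by apply: measurable_open_state; exact: open_obox. Qed.

Lemma continuous_measurable_state (f : S -> R) :
  continuous f -> measurable_fun setT f.
Proof.
move=> /continuousP cf; apply: (measurability _ (measurable_realfun.RGenOpens.measurableE R)).
move=> _ [_ [a [b ->] <-]]; rewrite setTI.
by apply: measurable_open_state; apply: cf; exact: interval_open.
Qed.

Lemma setI_closed_oboxes : setI_closed oboxes.
Proof.
move=> _ _ [a [b ->]] [c [d ->]].
exists (fun i => Num.max (a i) (c i)), (fun i => Num.min (b i) (d i)).
apply/seteqP; split => [x [xab xcd] i|x xabcd].
  by rewrite gt_max lt_min; have /andP[-> ->] := xab i; exact: xcd.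
by split => i; have := xabcd i;
  rewrite gt_max lt_min => /andP[/andP[ax cx] /andP[xb xd]]; apply/andP.
Qed.

Definition rbox (p : {ffun 'I_L -> rat * rat}) : set S :=
  obox (fun i => ratr (p i).1) (fun i => ratr (p i).2).

Lemma open_state_rbox (U : set S) x : open U -> U x ->
  exists2 p, rbox p x & rbox p `<=` U.
Proof.
move=> [V oV <-] Vx.
have [P Px PV] : nbhs (row_of x) V by apply: open_nbhs_nbhs.
have /fin_all_exists[q qP] : forall i : 'I_L, exists q : rat * rat,
    (row_of x ord0 i \in `](ratr q.1 : R), (ratr q.2 : R)[) /\
    (`](ratr q.1 : R), (ratr q.2 : R)[%classic `<=` P ord0 i).
  move=> i; have /nbhs_ballP[e /= e0 eP] := Px ord0 i.
  have [|q1 q1P] := @rat_in_itvoo R (row_of x ord0 i - e) (row_of x ord0 i).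
    by rewrite ltrBlDr ltrDl.
  have [|q2 q2P] := @rat_in_itvoo R (row_of x ord0 i) (row_of x ord0 i + e).
    by rewrite ltrDl.
  move: q1P q2P; rewrite !in_itv/= => /andP[q1l q1r] /andP[q2l q2r].
  exists (q1, q2); split; first by rewrite in_itv/= q1r.
  move=> y; rewrite /= in_itv/= => /andP[y1 y2]; apply: eP.
  by rewrite /ball/= ltr_distlC; apply/andP; split; lra.
exists [ffun i => q i] => [i|y yq]; first by rewrite !ffunE; have [] := qP i.
apply: PV => k i; rewrite (ord1 k); apply: (qP i).2.
by have := yq i; rewrite !ffunE /= in_itv.
Qed.

(** Every open set is the union of the rational boxes it contains, and there are countably many of
    these. Measurability of maps and equality of measures can thus be tested on coordinate boxes. *)
Lemma measurable_state_oboxes : @measurable _ S = <<s oboxes>>.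
Proof.
apply/seteqP; split; last first.
  apply: smallest_sub; first exact: sigma_algebra_measurable.
  by move=> _ [a [b ->]]; exact: measurable_obox.
apply: smallest_sub; first exact: smallest_sigma_algebra.
move=> U oU.
(* Boxes not contained in [U] are replaced by the empty set, so that the union runs over the whole
   countable type of rational boxes. *)
pose F p := if `[< rbox p `<=` U >] then rbox p else set0.
have -> : U = \bigcup_p F p.
  apply/seteqP; split => [x Ux|x [p _]]; rewrite /F.
    by have [p px pU] := open_state_rbox oU Ux; exists p => //; case: asboolP.
  by case: asboolP => // pU; exact: pU.
apply: (@countable_bigcupT_measurable _ (g_sigma_algebraType oboxes)) => // p.
rewrite /F; case: asboolP => _; last exact: measurable0.
by apply: sub_sigma_algebra; exists (fun i => ratr (p i).1), (fun i => ratr (p i).2).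
Qed.

Lemma measurable_to_state d (T : measurableType d) (f : T -> S) :
  (forall i, measurable_fun setT (fun t => row_of (f t) ord0 i)) ->
  measurable_fun setT f.
Proof.
move=> mf; apply: (measurability _ measurable_state_oboxes).
move=> _ [_ [a [b ->]] <-]; rewrite setTI.
have -> : f @^-1` obox a b = \bigcap_i
    ((fun t => row_of (f t) ord0 i) @^-1` `]a i, b i[%classic).
  by apply/seteqP; split => t H i; [move=> _|have := H i I]; rewrite /= in_itv/=;
    [exact: H|].
apply: fin_bigcap_measurable => // i _.
by rewrite -[X in measurable X]setTI; apply: mf.
Qed.

(** The lower bound -1 lies strictly below every coordinate, so that open boxes also cover the faces
    of the orthant. *)
Lemma oboxes_cover : \bigcup_n obox (fun=> -1) (fun=> n%:R) = setT.
Proof.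
apply/seteqP; split => // x _.
exists (\max_(i < L) (Num.truncn (row_of x ord0 i)).+1)%N => // i.
rewrite (lt_le_trans _ (row_of_ge0 x i)) ?ltrN10//=.
have /andP[_ h] := truncn_itv (row_of_ge0 x i).
by rewrite (lt_le_trans h)// ler_nat; exact: leq_bigmax.
Qed.

(** Open boxes form a pi-system generating the Borel sets. They are kept open because smooth bumps
    converge pointwise to their indicators. *)
Lemma state_measure_unique (m1 m2 : {measure set S -> \bar R}) :
  (m1 setT < +oo)%E -> (forall a b, m1 (obox a b) = m2 (obox a b)) ->
  forall A, measurable A -> m1 A = m2 A.
Proof.
move=> m1T m12; apply: (measure_unique oboxes (fun n => obox (fun=> -1) (fun=> n%:R))).
- exact: measurable_state_oboxes.
- exact: setI_closed_oboxes.
- by move=> n; exists (fun=> -1), (fun=> n%:R).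
- exact: oboxes_cover.
- by move=> _ [a [b ->]]; exact: m12.
- move=> k; apply: le_lt_trans m1T; apply: le_measure; rewrite ?inE//.
  exact: measurable_obox.
Qed.

End state_space.

(** * Product measures and resampling *)

Section product_measure_existence.
Context (R : realType).
Local Notation RM := (measurableTypeR R).

(** Induction on the number of coordinates, with one binary product at each step. The sample space
    is left abstract: only the coordinate maps and their joint law are used afterwards. *)
Lemma independent_coordinates (n : nat) (m : nat -> probability RM R) :
  exists d (T : measurableType d) (Q : probability T R) (X : nat -> T -> RM),
    (forall i, measurable_fun setT (X i)) /\
    forall A : nat -> set R, (forall i, measurable (A i)) ->
      Q [set t | forall i, (i < n)%N -> A i (X i t)] =
      (\prod_(i < n) m i (A i))%E.
Proof.
elim: n => [|n [d [T [Q [X [mX QX]]]]]].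
  exists _, unit, (@dirac _ unit tt R), (fun _ _ => 0); split => // A mA.
  rewrite big_ord0 (_ : [set _ | _] = setT) ?probability_setT//.
  by apply/seteqP; split.
exists _, (T * RM)%type, (Q \x m n)%E,
  (fun i t => if (i < n)%N then X i t.1 else t.2); split => [i|A mA].
  by case: (i < n)%N; [exact: measurableT_comp|exact: measurable_snd].
rewrite big_ord_recr/= -QX//.
rewrite (_ : [set _ | _] =
    [set t | forall i, (i < n)%N -> A i (X i t)] `*` A n); last first.
  apply/seteqP; split => [[t y]/= H|[t y]/= [H yA] i].
    by split => [i iltn|]; [have := H i (ltnW iltn); rewrite iltn|
      have := H n (ltnSn n); rewrite ltnn].
  rewrite ltnS leq_eqVlt => /predU1P[->|iltn]; first by rewrite ltnn.
  by rewrite iltn; exact: H.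
rewrite product_measure1E//; last exact: (mA n).
rewrite (_ : [set _ | _] = \bigcap_(i in `I_n) (X i @^-1` A i)).
  apply: fin_bigcap_measurable => // i _.
  by rewrite -[X in measurable X]setTI; exact: (mX i measurableT _ (mA i)).
by apply/seteqP; split => t H i; exact: (H i).
Qed.

End product_measure_existence.

Section product_measure_on_orthant.
Context (R : realType) (L : nat).
Local Notation S := (state R L).
Local Notation RM := (measurableTypeR R).

Lemma probability_supported d (T : measurableType d) (m : probability T R)
    (D B : set T) : measurable D -> m D = 1%E -> measurable B ->
  m (B `&` D) = m B.
Proof.
move=> mD mD1 mB; rewrite [RHS](measureDI _ mB mD).
rewrite [X in _ = (X + _)%E](_ : _ = 0%E) ?add0e//; apply/eqP.
rewrite -measure_le0 (@le_trans _ _ (m (~` D)))//.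
  apply: le_measure; rewrite ?inE; [exact: measurableD|exact: measurableC|].
  by move=> x [].
by rewrite probability_setC// mD1 subee.
Qed.

(** Law of the clamped independent coordinates. Since each [m i] gives full mass to the half-line,
    clamping does not alter the marginals. *)
Lemma exists_product_measure (m : 'I_L -> probability RM R) :
  (forall i, m i `[0, +oo[%classic = 1%E) ->
  exists mu : probability S R, is_product_measure mu m.
Proof.
move=> m1.
pose m' (i : nat) : probability RM R :=
  if insub i is Some j then m j else dirac (0 : RM).
have [d [T [Q [X [mX QX]]]]] := independent_coordinates L m'.
pose phi (t : T) : S := state_of (\row_i X i t).
have mphi : measurable_fun setT phi.
  apply: measurable_to_state => i.
  rewrite (_ : (fun t => _) = (X i : T -> R) \max cst 0); last first.
    by apply/funext => t; rewrite row_of_state_of mxE.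
  by apply: measurable_maxr => //; exact: mX.
exists (distribution Q (mfun_Sub (mem_set mphi))) => A mA.
pose B i := (fun y : R => Num.max y 0) @^-1` A i.
have mB i : measurable (B i).
  rewrite -[X in measurable X]setTI.
  by apply: measurable_maxr => //; exact: measurable_cst.
transitivity (Q [set t | forall i, (i < L)%N ->
    (if insub i is Some j then B j else setT) (X i t)]).
  congr (Q _).
  apply/seteqP; split => [t H i iL|t H i].
    by rewrite insubT; have := H (Ordinal iL); rewrite row_of_state_of mxE.
  have := H i (ltn_ord i); rewrite valK.
  by rewrite /B/= row_of_state_of mxE.
rewrite (QX (fun i => if insub i is Some j then B j else setT)); last by move=> i; case: insub.
apply: eq_bigr => i _; rewrite /m' !valK.
rewrite -(probability_supported _ (m1 i) (mB i))//.
rewrite -(probability_supported _ (m1 i) (mA i))//.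
congr (m i _); apply/seteqP; split => y [] /=; rewrite in_itv/= andbT => + y0;
  by rewrite /B/= (max_idPl _).
Qed.
Definition resample (i : 'I_L) (p : S * RM) : S :=
  state_of (\row_j if j == i then p.2 else row_of p.1 ord0 j).

Lemma row_of_resample i x y : 0 <= y ->
  row_of (resample i (x, y)) = \row_j if j == i then y else row_of x ord0 j.
Proof.
move=> y0; apply: state_ofK => j; rewrite mxE.
by case: ifP => // _; exact: row_of_ge0.
Qed.

Lemma measurable_resample i : measurable_fun setT (resample i).
Proof.
apply: measurable_to_state => j.
rewrite (_ : (fun p => _) =
    (fun p : S * RM => if j == i then p.2 else row_of p.1 ord0 j : R) \max cst 0).
  apply: measurable_maxr; last exact: measurable_cst.
  case: (j == i); first exact: measurable_snd.
  apply: (@measurableT_comp _ _ _ _ _ _ (fun x : S => row_of x ord0 j)) => //.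
  by apply: continuous_measurable_state; exact: continuous_coord_state.
by apply/funext => -[x y]; rewrite row_of_state_of mxE.
Qed.

(** On a box, the old coordinate [i] becomes unconstrained and contributes a factor 1, while the
    fresh one contributes the factor [m i] that was lost. *)
Lemma resample_product (m : 'I_L -> probability RM R) (mu : probability S R) :
  (forall i, m i `[0, +oo[%classic = 1%E) -> is_product_measure mu m ->
  forall i A, measurable A -> (mu \x m i)%E (resample i @^-1` A) = mu A.
Proof.
move=> m1 muE i A mA.
pose nu := distribution (mu \x m i)%E (mfun_Sub (mem_set (measurable_resample i))).
apply: (@state_measure_unique _ _ nu mu) => // [|a b].
  exact: fin_num_fun_lty.
pose J j : set R := `]a j, b j[%classic.
have mJ j : measurable (J j) by exact: measurable_itv.
have oboxE : obox a b = [set x : S | forall j, J j (row_of x ord0 j)].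
  by apply/seteqP; split => x H j; have := H j; rewrite /J/= in_itv.
rewrite {2}oboxE muE//.
pose K := (fun y : R => Num.max y 0) @^-1` J i.
have mK : measurable K.
  rewrite -[X in measurable X]setTI.
  by apply: measurable_maxr => //; exact: measurable_cst.
transitivity ((mu \x m i)%E
  ([set x : S | forall j, (if j == i then setT else J j) (row_of x ord0 j)] `*` K)).
  rewrite -[LHS]/((mu \x m i)%E (resample i @^-1` obox a b)).
  congr ((mu \x m i)%E _); apply/seteqP; split => [[x y]/= H|[x y]/= [H yK] j].
    split => [j|].
      case: eqP => // /eqP ji; have := H j; rewrite row_of_state_of mxE (negbTE ji).
      by rewrite (max_idPl (row_of_ge0 _ _)) /J/= in_itv.
    by have := H i; rewrite row_of_state_of mxE eqxx /K/J/= in_itv.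
  rewrite row_of_state_of mxE; case: eqP => [->|/eqP ji].
    by move: yK; rewrite /K/J/= in_itv.
  have := H j; rewrite (negbTE ji) /J/= in_itv/=.
  by rewrite (max_idPl (row_of_ge0 _ _)).
rewrite product_measure1E//; last first.
  rewrite (_ : [set _ | _] = \bigcap_j ((fun x : S => row_of x ord0 j) @^-1`
      (if j == i then setT else J j))); last first.
    by apply/seteqP; split => x H j; [move=> _; exact: (H j)|exact: (H j I)].
  apply: fin_bigcap_measurable => // j _.
  rewrite -[X in measurable X]setTI.
  apply: (continuous_measurable_state (@continuous_coord_state _ _ j)) => //.
  by case: ifP.
rewrite (muE (fun j => if j == i then setT else J j)); last by move=> j; case: ifP.
rewrite (bigD1 i)//= [RHS](bigD1 i)//= eqxx probability_setT mul1e muleC.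
congr (_ * _)%E; last by apply: eq_bigr => j /negbTE ->.
rewrite -(probability_supported _ (m1 i) mK)//.
rewrite -[RHS](probability_supported _ (m1 i) (mJ i))//.
congr (m i _); apply/seteqP; split => y [] /=; rewrite in_itv/= andbT => + y0;
  by rewrite /K/= (max_idPl _).
Qed.

(** The expectation of [H] equals that of [H] after resampling coordinate [i], and Fubini integrates
    the fresh coordinate first. This reduces vanishing on the orthant to vanishing on each line
    parallel to an axis. *)
Lemma integral_resample0 (m : 'I_L -> probability RM R) (mu : probability S R)
    (i : 'I_L) (H : S -> R) :
  (forall i, m i `[0, +oo[%classic = 1%E) -> is_product_measure mu m ->
  measurable_fun setT H -> (exists M, forall x, `|H x| <= M) ->
  (forall x, \int[m i]_y (H (resample i (x, y)))%:E = 0)%E ->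
  (\int[mu]_x (H x)%:E = 0)%E.
Proof.
move=> m1 muE mH [M HM] H0.
have HI (d : measure_display) (T : measurableType d) (P : probability T R) (f : T -> S) :
    measurable_fun setT f -> P.-integrable setT (EFin \o H \o f).
  move=> mf; apply: measurable_bounded_integrable => //.
  - exact: fin_num_fun_lty.
  - exact: measurableT_comp.
  - exists M; split; first by rewrite num_real.
    by move=> r Mr x _; rewrite /= (le_trans (HM _))// ltW.
have mR := measurable_resample i.
transitivity (\int[pushforward (mu \x m i)%E (resample i)]_x (H x)%:E)%E.
  have /= <- := @eq_measure_integral _ S R setT mu
    [the {measure set S -> \bar R} of pushforward (mu \x m i)%E (resample i)]
    (EFin \o H) => //.
  by move=> A mA _; exact: (resample_product m1 muE i mA).
rewrite integral_pushforward//; last 2 first.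
- exact: measurableT_comp.
- exact: HI.
rewrite preimage_setT -integral12_prod_meas1; last exact: HI.
by apply: integral0_eq => x _; exact: H0.
Qed.

End product_measure_on_orthant.

(** * Smooth bump functions *)

Section flat_functions.
Context {R : realType}.

(** The function y^(-k) e^(-1/y), extended by 0. The negative powers make the family stable under
    differentiation up to linear combinations, which gives smoothness at all orders at once. *)
Definition flat (k : nat) (y : R) : R :=
  if 0 < y then y^-1 ^+ k * expR (- y^-1) else 0.

Lemma flat_le0 k y : y <= 0 -> flat k y = 0.
Proof. by rewrite /flat leNgt => /negbTE ->. Qed.

Lemma flat_ge0 k y : 0 <= flat k y.
Proof.
rewrite /flat; case: ifP => // y0.
by rewrite mulr_ge0 ?expR_ge0// exprn_ge0// invr_ge0 ltW.
Qed.

Lemma flat0_le1 y : flat 0 y <= 1.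
Proof.
rewrite /flat; case: ifP => // y0.
by rewrite expr0 mul1r -expR0 ler_expR oppr_le0 invr_ge0 ltW.
Qed.

(** Keep the term of degree k + 2 in the exponential series at 1/y. The two spare powers of y make
    the difference quotient at the origin tend to 0. *)
Lemma flat_le_sqr k y : flat k y <= (k.+2)`!%:R * y ^+ 2.
Proof.
have [y0|y0] := leP y 0.
  by rewrite flat_le0// mulr_ge0// sqr_ge0.
rewrite /flat y0 expRN -[leLHS]/(_ / _) ler_pdivrMr ?expR_gt0//.
have : y^-1 ^+ k.+2 / (k.+2)`!%:R <= expR y^-1.
  by rewrite (le_trans _ (expR_ge1Dxn k.+1 _)) ?invr_ge0 ?ltW// ltrDr.
rewrite ler_pdivrMr ?ltr0n ?fact_gt0// => h.
rewrite (_ : y^-1 ^+ k = y ^+ 2 * y^-1 ^+ k.+2).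
  rewrite [leRHS]mulrAC [leRHS]mulrC ler_wpM2l ?sqr_ge0// mulrC//.
rewrite exprVn exprVn -(addn2 k) exprD; field.
by rewrite expf_neq0 ?gt_eqF.
Qed.

Lemma is_derive_flat k (y : R) :
  is_derive y 1 (flat k) (flat k.+2 y - k%:R * flat k.+1 y).
Proof.
have [y0|y0|->] := ltgtP y 0.
- rewrite !flat_le0 ?ltW// mulr0 subr0.
  apply: (@near_eq_is_derive _ _ _ (cst 0)).
  by near=> z; rewrite flat_le0// ltW//; near: z; exact: lt_nbhsl.
- apply: (@near_eq_is_derive _ _ _ ((fun t => t ^+ k * expR (- t)) \o (fun z => z^-1))).
    near=> z; rewrite /flat/= ifT//; near: z; exact: lt_nbhsr.
  have dV : is_derive y 1 (fun z : R => z^-1) (- y ^- 2).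
    apply: is_derive_eq; first by apply: is_deriveV; rewrite gt_eqF.
    by rewrite /GRing.scale/= mulr1.
  have dX : is_derive y^-1 1 (fun t : R => t ^+ k) (k%:R * y^-1 ^+ k.-1).
    by split; [exact: exprn_derivable|rewrite exp_derive /GRing.scale/= mulr1].
  have dE : is_derive y^-1 1 (expR \o -%R) (expR (- y^-1) * -1).
    exact: is_derive1_comp.
  have dG : is_derive y^-1 1 (fun t : R => t ^+ k * expR (- t)) _ :=
    is_deriveM dX dE.
  apply: is_derive_eq.
  rewrite /flat y0 /GRing.scale/= -exprVn; case: k {dG dX} => [|k]/=.
    by rewrite mul0r; ring.
  by rewrite !exprS; ring.
- rewrite !flat_le0// mulr0 subr0.
  pose C : R := (k.+2)`!%:R.
  have quot (h : R) : `|h^-1 * flat k h| <= C * `|h|.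
    have [h0|h0] := leP h 0; first by rewrite flat_le0// mulr0 normr0 mulr_ge0.
    rewrite ger0_norm ?mulr_ge0 ?invr_ge0 ?flat_ge0 ?(ltW h0)// gtr0_norm//.
    by rewrite [leLHS]mulrC ler_pdivrMr// (le_trans (flat_le_sqr _ _))// expr2 mulrA.
  have lim0 : h^-1 *: ((flat k \o shift 0) (h *: 1) - flat k 0) @[h --> 0^'] --> (0 : R).
    apply/cvgr0Pnorm_le => e e0; near=> h.
    rewrite /= [flat k 0]flat_le0// subr0 addr0 /GRing.scale/= mulr1 (le_trans (quot _))//.
    rewrite mulrC -ler_pdivlMr ?ltr0n ?fact_gt0//.
    near: h; apply: dnbhs0_le.
    by rewrite divr_gt0 ?ltr0n ?fact_gt0.
  by split; [apply/cvg_ex; exists 0|exact: cvg_lim].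
Unshelve. all: end_near. Qed.

End flat_functions.
Section bump_functions.
Context {R : realType} {L : nat}.
Local Notation V := 'rV[R]_L.

(** The algebra generated by constants and flat functions of one affine coordinate. It is stable
    under partial derivatives and made of differentiable functions, so its members are smooth
    without any formula for iterated derivatives. *)
Inductive flat_poly : (V -> R) -> Prop :=
| flat_poly_cst c : flat_poly (cst c)
| flat_poly_atom k l c d : flat_poly (fun x => flat k (c * x ord0 l + d))
| flat_polyD F G : flat_poly F -> flat_poly G -> flat_poly (F + G)
| flat_polyM F G : flat_poly F -> flat_poly G -> flat_poly (F * G).

Lemma is_derive_affine_coord (c d : R) (l : 'I_L) (x v : V) :
  is_derive (0 : R) (1 : R) (fun h : R => c * (h *: v + x) ord0 l + d)
            (c * v ord0 l).
Proof.
rewrite (_ : (fun h => _) =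
    ((c * v ord0 l) \*: id + cst (c * x ord0 l + d))).
  by apply: is_derive_eq; rewrite addr0 /GRing.scale/= mulr1.
apply/funext => h /=; rewrite !mxE.
rewrite -[RHS]/(c * v ord0 l * h + (c * x ord0 l + d)); ring.
Qed.

Lemma differentiable_atom k l c d (x : V) :
  differentiable (fun x : V => flat k (c * x ord0 l + d)) x.
Proof.
apply: (@differentiable_comp _ _ _ _ (fun x : V => c * x ord0 l + d) (flat k)).
  apply: differentiableD; last exact: differentiable_cst.
  by apply: differentiableM; [exact: differentiable_cst|
    exact: differentiable_coord].
by apply/derivable1_diffP; have [] := is_derive_flat k (c * x ord0 l + d).
Qed.

Lemma partial_atom k l c d i :
  partial i (fun x : V => flat k (c * x ord0 l + d)) =
  cst (c * (i == l)%:R) * ((fun x : V => flat k.+2 (c * x ord0 l + d)) +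
    cst (- k%:R) * (fun x : V => flat k.+1 (c * x ord0 l + d))).
Proof.
apply/funext => x; rewrite /partial.
have -> : 'D_(delta_mx ord0 i) (fun x : V => flat k (c * x ord0 l + d)) x =
    'D_1 (fun h : R => flat k (c * (h *: delta_mx ord0 i + x) ord0 l + d)) 0.
  rewrite /derive; apply: (congr1 (fun f : R -> R => lim (f @ 0^'))).
  apply/funext => h /=.
  by rewrite scale0r add0r addr0 /GRing.scale/= mulr1.
have H1 := is_derive_affine_coord c d l x (delta_mx ord0 i).
have H2 := is_derive_flat k (c * (0 *: delta_mx ord0 i + x) ord0 l + d).
have H := @is_derive1_comp _ (flat k)
  (fun h => c * (h *: delta_mx ord0 i + x) ord0 l + d) 0 _ _ H2 H1.
rewrite (@derive_val _ _ _ _ _ _ _ H) scale0r add0r mxE eqxx/= eq_sym.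
by rewrite !fctE/=; ring.
Qed.

Lemma flat_poly_differentiable F x : flat_poly F -> differentiable F x.
Proof.
elim => [c|k l c d|G H _ dG _ dH|G H _ dG _ dH].
- exact: differentiable_cst.
- exact: differentiable_atom.
- exact: differentiableD.
- exact: differentiableM.
Qed.

Lemma flat_poly_partial i F : flat_poly F -> flat_poly (partial i F).
Proof.
elim => [c|k l c d|G H fG pG fH pH|G H fG pG fH pH].
- rewrite (_ : partial i _ = cst 0); first exact: flat_poly_cst.
  by apply/funext => x; rewrite /partial derive_cst.
- rewrite partial_atom; apply: flat_polyM; first exact: flat_poly_cst.
  apply: flat_polyD; first exact: flat_poly_atom.
  by apply: flat_polyM; [exact: flat_poly_cst|exact: flat_poly_atom].
- rewrite (_ : partial i _ = partial i G + partial i H).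
    exact: flat_polyD.
  by apply/funext => x; rewrite /partial deriveD//;
    apply: diff_derivable; exact: flat_poly_differentiable.
- rewrite (_ : partial i _ = G * partial i H + H * partial i G).
    by apply: flat_polyD; exact: flat_polyM.
  by apply/funext => x; rewrite /partial deriveM//;
    apply: diff_derivable; exact: flat_poly_differentiable.
Qed.

Lemma smooth_flat_poly F : flat_poly F -> smooth F.
Proof.
move=> fF s x; apply: flat_poly_differentiable.
by elim: s => //= i s; exact: flat_poly_partial.
Qed.

(** Inside the open box each factor has the form e^(-1/((n+1) y)) with y > 0 and tends to 1.
    Outside, some factor is 0 for every [n]. *)
Definition box_bump (a b : 'I_L -> R) (n : nat) (x : V) : R :=
  \prod_(l < L) (flat 0 (n.+1%:R * (x ord0 l - a l)) *
                 flat 0 (n.+1%:R * (b l - x ord0 l))).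

Lemma smooth_bump a b n : smooth (box_bump a b n).
Proof.
apply: smooth_flat_poly.
rewrite (_ : box_bump a b n = \prod_(l < L)
    ((fun x : V => flat 0 (n.+1%:R * x ord0 l + - (n.+1%:R * a l))) *
     (fun x : V => flat 0 (- n.+1%:R * x ord0 l + n.+1%:R * b l)))); last first.
  apply/funext => x; rewrite /box_bump fct_prodE/=; apply: eq_bigr => l _.
  by rewrite fctE; congr (flat _ _ * flat _ _); ring.
elim/big_ind : _ => [|F G|l _].
- exact: (flat_poly_cst 1).
- exact: flat_polyM.
- by apply: flat_polyM; exact: flat_poly_atom.
Qed.

Lemma bump_ge0 a b n (x : V) : 0 <= box_bump a b n x.
Proof. by apply: prodr_ge0 => l _; rewrite mulr_ge0 ?flat_ge0. Qed.

Lemma bump_le1 a b n (x : V) : box_bump a b n x <= 1.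
Proof.
apply: prodr_ile1 => l _; rewrite mulr_ge0 ?flat_ge0//=.
by rewrite mulr_ile1 ?flat_ge0 ?flat0_le1.
Qed.

Lemma bump_eq0 a b n (x : V) l : ~~ (a l < x ord0 l < b l) -> box_bump a b n x = 0.
Proof.
move=> xab; rewrite /box_bump (bigD1 l)//=; suff -> : flat 0 (n.+1%:R * (x ord0 l - a l)) *
  flat 0 (n.+1%:R * (b l - x ord0 l)) = 0 by rewrite mul0r.
have n0 : (0 : R) < n.+1%:R by rewrite ltr0n.
move: xab; rewrite negb_and -!leNgt => /orP[h|h].
  by rewrite flat_le0 ?mul0r// pmulr_rle0// subr_le0.
by rewrite mulrC flat_le0 ?mul0r// pmulr_rle0// subr_le0.
Qed.

Lemma flat0_cvg (y : R) : 0 < y -> flat 0 (n.+1%:R * y) @[n --> \oo] --> (1 : R).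
Proof.
move=> y0.
rewrite (_ : (fun n => _) = (fun n => expR (- (y^-1 * n.+1%:R^-1)))).
  rewrite -[X in _ --> X](@expR0 R).
  have h : - (y^-1 * n.+1%:R^-1) @[n --> \oo] --> (0 : R).
    rewrite -[X in _ --> X]oppr0 -[X in _ --> - X](mulr0 y^-1); apply: cvgN.
    by apply: cvgMl_tmp; exact: cvg_harmonic.
  apply: (@continuous_cvg _ _ _ _ _ (fun n => - (y^-1 * n.+1%:R^-1)) expR) => //.
  exact: continuous_expR.
by apply/funext => n; rewrite /flat mulr_gt0// expr0 mul1r invfM mulrC.
Qed.

Lemma bump_cvg a b (x : V) : (forall l, a l < x ord0 l < b l) ->
  box_bump a b n x @[n --> \oo] --> (1 : R).
Proof.
move=> xab; rewrite (_ : 1 = \prod_(l < L) (1 * 1)); last first.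
  by rewrite big1// => l _; rewrite mulr1.
apply: (cvg_big (@mul_continuous R)) => l _; have /andP[ax xb] := xab l.
by apply: cvgM; apply: flat0_cvg; rewrite subr_gt0.
Qed.

(** Image under the continuous retraction of a product of segments, compact in the full space; the
    lower ends are first raised to at least 0. *)
Lemma compact_closed_box (a b : 'I_L -> R) :
  compact [set x : state R L | forall l, a l <= row_of x ord0 l <= b l].
Proof.
have -> : [set x : state R L | forall l, a l <= row_of x ord0 l <= b l] =
    (@state_of R L) @` [set v : V | forall l, `[Num.max (a l) 0, b l]%classic (v ord0 l)].
  apply/seteqP; split => [x xab|_ [v vab <-] l].
    exists (row_of x); last exact: row_ofK.
    by move=> l /=; rewrite in_itv/= ge_max row_of_ge0 andbT.
  have := vab l; rewrite /= in_itv/= ge_max row_of_state_of => /andP[/andP[av v0] vb].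
  by rewrite (max_idPl v0) av.
apply: continuous_compact.
  exact: (continuous_subspaceT (@continuous_state_of R L)).
apply: (@rV_compact R L (fun l => `[Num.max (a l) 0, b l]%classic)) => i.
exact: segment_compact.
Qed.

Lemma bump_test_function a b n : test_function (box_bump a b n).
Proof.
split; first exact: smooth_bump.
exists [set x | forall l, a l <= row_of x ord0 l <= b l].
  exact: compact_closed_box.
move=> x /existsNP[l /negP nxab]; apply: (@bump_eq0 _ _ _ _ l).
by apply: contra nxab => /andP[/ltW -> /ltW ->].
Qed.

Lemma compact_state_bounded (K : set (state R L)) : compact K ->
  exists M : R, 0 <= M /\ forall x, K x -> forall i, row_of x ord0 i <= M.
Proof.
move=> cK.
have bK i : \forall M \near +oo, forall x, K x -> row_of x ord0 i <= M.
  have /compact_bounded[M [Mreal HM]] : compact ((fun x => row_of x ord0 i) @` K).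
    apply: continuous_compact => //.
    exact: (continuous_subspaceT (@continuous_coord_state R L i)).
  exists M; split => // N MN x Kx; rewrite (le_trans (ler_norm _))//.
  by apply: (HM N MN); exists x.
have [M [Mreal HM]] := @filter_forall _ _ _ _ _ bK.
exists (`|M| + 1); split => [|x Kx i]; first by rewrite addr_ge0.
by apply: HM => //; rewrite (le_lt_trans (ler_norm _))// ltrDl.
Qed.

End bump_functions.

(** * The one-dimensional weight *)

Section exhaustion.
Context d (T : measurableType d) (R : realType).
Local Open Scope ereal_scope.

(** Monotone convergence for the positive and negative parts separately; integrability keeps the
    difference of the limits from being indeterminate. *)
Lemma cvg_integral_bigcup (mu : {measure set T -> \bar R}) (E : (set T)^nat)
    (f : T -> \bar R) :
  nondecreasing_seq E -> (forall n, measurable (E n)) ->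
  mu.-integrable (\bigcup_n E n) f ->
  \int[mu]_(x in E n) f x @[n --> \oo] --> \int[mu]_(x in \bigcup_n E n) f x.
Proof.
move=> ndE mE fi; have mUE : measurable (\bigcup_n E n) by exact: bigcupT_measurable.
have mf n : measurable_fun (E n) f.
  by apply: (measurable_funS mUE _ (measurable_int mu fi)); exact: bigcup_sup.
rewrite integralE; under eq_fun do rewrite integralE.
apply: cvgeB.
- by rewrite fin_num_adde_defl// fin_numN integrable_neg_fin_num.
- apply: ge0_nondecreasing_set_cvg_integral => //.
  by move=> n; exact: measurable_funepos.
- apply: ge0_nondecreasing_set_cvg_integral => //.
  by move=> n; exact: measurable_funeneg.
Qed.

End exhaustion.

Section half_line.
Context {R : realType}.
Local Notation mu := (@lebesgue_measure R).

(** An exhaustion of the open half-line staying away from 0, where the weight may blow up. The shift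
    by 2 makes every segment nondegenerate. *)
Definition seg (n : nat) : set R := `[n.+2%:R^-1, n.+2%:R]%classic.

Lemma nondecreasing_seg : nondecreasing_seq seg.
Proof.
move=> m n mn; rewrite subsetEset => x; rewrite /seg/= !in_itv/= => /andP[mx xm].
rewrite (le_trans _ mx) ?(le_trans xm) ?ler_nat//.
by rewrite lef_pV2 ?posrE ?ltr0n// ler_nat.
Qed.

Lemma bigcup_seg : \bigcup_n seg n = `]0, +oo[%classic.
Proof.
apply/seteqP; split => x.
  move=> [n _]; rewrite /seg/= !in_itv/= andbT => /andP[nx _].
  by rewrite (lt_le_trans _ nx)// invr_gt0 ltr0n.
rewrite /= in_itv/= andbT => x0.
exists (maxn (Num.truncn x) (Num.truncn x^-1)) => //; rewrite /seg/= in_itv/=.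
have xt : x < (Num.truncn x).+1%:R by have /andP[] := truncn_itv (ltW x0).
have xVt : x^-1 < (Num.truncn x^-1).+1%:R.
  by have /andP[] := truncn_itv (ltW (etrans (invr_gt0 x) x0)).
apply/andP; split; last first.
  by rewrite (le_trans (ltW xt))// ler_nat ltnS leqW// leq_maxl.
rewrite -[leRHS]invrK lef_pV2 ?posrE ?ltr0n ?invr_gt0//.
by rewrite (le_trans (ltW xVt))// ler_nat ltnS leqW// leq_maxr.
Qed.

Lemma FTC_segment (f F : R -> R) (s t : R) : 0 < s -> s < t ->
  (forall x : R, 0 < x -> is_derive x 1 F (f x)) ->
  (forall x : R, 0 < x -> {for x, continuous f}) ->
  (\int[mu]_(x in `[s, t]) (f x)%:E = (F t - F s)%:E)%E.
Proof.
move=> s0 st dF cf; have t0 := lt_trans s0 st.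
have cF x : 0 < x -> {for x, continuous F}.
  by move=> /dF[+ _] => /derivable1_diffP/differentiable_continuous.
rewrite (@continuous_FTC2 _ f F)//.
- apply: continuous_in_subspaceT => x; rewrite inE/= in_itv/= => /andP[sx _].
  by apply: cf; exact: lt_le_trans sx.
- split.
  + by move=> x; rewrite in_itv/= => /andP[sx _]; have [] := dF _ (lt_trans s0 sx).
  + by apply: cvg_at_right_filter; exact: cF.
  + by apply: cvg_at_left_filter; exact: cF.
- move=> x; rewrite in_itv/= => /andP[sx _].
  by rewrite derive1E; have [_ ->] := dF _ (lt_trans s0 sx).
Qed.

End half_line.
Section weight.
Context {R : realType}.
Local Notation mu := (@lebesgue_measure R).
Variables (tau b c : R).
Hypothesis tau0 : 0 < tau.

(* [wt] is [abep_weight] with [tau = 2 sigma], [b = 2 k] and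
   [c = 4 sigma k i + gamma]. *)
Definition alpha (x : R) : R := 1 - expR (- (tau * x)).
Definition wt (x : R) : R := alpha x `^ (b - 1) * expR (- (c * x)).

Lemma is_derive_expRN (d x : R) :
  is_derive x 1 (fun x : R => expR (- (d * x))) (- d * expR (- (d * x))).
Proof.
have dl : is_derive x 1 (fun x : R => - (d * x)) (- d).
  rewrite (_ : (fun x => _) = (- d) \*: id).
    by apply: is_derive_eq; rewrite /GRing.scale/= mulr1.
  by apply/funext => y; rewrite -mulNr.
have H := @is_derive1_comp _ expR (fun x => - (d * x)) x _ _ (is_derive_expR _) dl.
by apply: is_derive_eq; rewrite mulrC.
Qed.

Lemma is_derive_alpha (x : R) : is_derive x 1 alpha (tau * expR (- (tau * x))).
Proof.
have H := is_derive_expRN tau x.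
have -> : alpha = cst 1 - (fun x : R => expR (- (tau * x))) by [].
by apply: is_derive_eq; rewrite sub0r mulNr opprK.
Qed.

Lemma alpha_gt0 x : 0 < x -> 0 < alpha x.
Proof. by move=> x0; rewrite subr_gt0 -expR0 ltr_expR oppr_lt0 mulr_gt0. Qed.

Lemma alpha_ge0 x : 0 <= x -> 0 <= alpha x.
Proof. by move=> x0; rewrite subr_ge0 -expR0 ler_expR oppr_le0 mulr_ge0// ltW. Qed.

Lemma alpha_lt1 x : alpha x < 1.
Proof. by rewrite ltrBlDr ltrDl expR_gt0. Qed.

Lemma alpha_le x : alpha x <= tau * x.
Proof. by have := expR_ge1Dx (- (tau * x)); rewrite /alpha; lra. Qed.

Lemma wt_ge0 x : 0 <= wt x.
Proof. by rewrite mulr_ge0 ?powR_ge0 ?expR_ge0. Qed.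

Lemma is_derive_powR_alpha (p x : R) : 0 < x ->
  is_derive x 1 (fun x => alpha x `^ p)
    (p * alpha x `^ (p - 1) * (tau * expR (- (tau * x)))).
Proof.
move=> x0; have H1 := is_derive_alpha x.
have H2 := is_derive1_powR p (alpha_gt0 x0).
have H := @is_derive1_comp _ (fun y : R => y `^ p) alpha x _ _ H2 H1.
by apply: is_derive_eq.
Qed.

Lemma continuous_wt (x : R) : 0 < x -> {for x, continuous wt}.
Proof.
move=> x0; apply: continuousM.
  have [+ _] := is_derive_powR_alpha (b - 1) x0.
  by move=> /derivable1_diffP/differentiable_continuous.
have [+ _] := is_derive_expRN c x.
by move=> /derivable1_diffP/differentiable_continuous.
Qed.

Lemma continuous_expRN (d : R) : continuous (fun x : R => expR (- (d * x))).
Proof.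
move=> x; have [+ _] := is_derive_expRN d x.
by move=> /derivable1_diffP/differentiable_continuous.
Qed.

Lemma measurable_wt : measurable_fun setT wt.
Proof.
apply: measurable_funM.
  apply: (measurableT_comp (measurable_powR (b - 1))).
  apply: measurable_funB; first exact: measurable_cst.
  by apply: continuous_measurable_fun; exact: continuous_expRN.
by apply: continuous_measurable_fun; exact: continuous_expRN.
Qed.

Lemma integral_wt_segs :
  (\int[mu]_(x in seg n) (wt x)%:E @[n --> \oo] -->
   \int[mu]_(x in `[0%R, +oo[) (wt x)%:E)%E.
Proof.
rewrite -integral_itv_obnd_cbnd; last first.
  by apply/measurable_funTS/measurableT_comp => //; exact: measurable_wt.
rewrite -bigcup_seg; apply: ge0_nondecreasing_set_cvg_integral.
- exact: nondecreasing_seg.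
- by move=> n; exact: measurable_itv.
- by move=> n; apply/measurable_funTS/measurableT_comp => //; exact: measurable_wt.
- by move=> n x _; rewrite lee_fin wt_ge0.
Qed.


Lemma seg_bounds (n : nat) : (0 : R) < n.+2%:R^-1 /\ (n.+2%:R^-1 : R) < n.+2%:R.
Proof.
split; first by rewrite invr_gt0 ltr0n.
by rewrite (@lt_trans _ _ 1)// ?ltr1n// invf_lt1 ?ltr1n ?ltr0n.
Qed.

(** A majorant with an elementary primitive. If e^(-tau x) > 1/2, then e^(-c x) <= 1 <= 2 e^(-tau
    x), which gives the constant 2. Otherwise 1/2 <= alpha < 1, and the power of alpha is at most 1
    or (1/2)^(b-1), according to the sign of b - 1. *)
Lemma wt_le x : 0 < c -> 0 < x -> wt x <=
  (1 + 2 + 2^-1 `^ (b - 1)) *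
    (alpha x `^ (b - 1) * expR (- (tau * x)) + expR (- (c * x))).
Proof.
move=> c0 x0; have a0 := alpha_gt0 x0; have a1 := alpha_lt1 x.
have e1 : expR (- (c * x)) <= 1.
  by rewrite -expR0 ler_expR oppr_le0 mulr_ge0// ltW.
have e0 := expR_gt0 (- (c * x)); have u0 := expR_gt0 (- (tau * x)).
have C0 : 0 < 2^-1 `^ (b - 1) :> R by rewrite powR_gt0.
have p0 := powR_gt0 (b - 1) a0.
rewrite /wt; set p := alpha x `^ (b - 1) in p0 *; set e := expR (- (c * x)) in e0 e1 *.
set u := expR (- (tau * x)) in u0 *; set C := 2^-1 `^ (b - 1) in C0 *.
have pu0 : 0 < p * u by rewrite mulr_gt0.
have Cpu0 : 0 < C * (p * u) by rewrite mulr_gt0.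
have Ce0 : 0 < C * e by rewrite mulr_gt0.
have [h|h] := leP u 2^-1.
  have : p <= 1 + C.
    have [b1|b1] := leP 0 (b - 1).
      suff : p <= 1 by lra.
      by rewrite -(powRr0 (alpha x)) /p; apply: ger_powR; rewrite ?a0 ?(ltW a1).
    suff : p <= C by lra.
    rewrite /p /C -[b - 1]opprK !(powRN _ (- _)) lef_pV2 ?posrE ?powR_gt0//.
    have h' : 2^-1 <= alpha x by move: h; rewrite /u /alpha; lra.
    by apply: ge0_ler_powR; rewrite ?nnegrE ?(ltW a0)//; lra.
  move=> pC; have pe : p * e <= (1 + C) * e by rewrite ler_wpM2r// ltW.
  lra.
have pe : p * e <= p * 1 by rewrite ler_wpM2l// ltW.
have pu2 : p * 2^-1 <= p * u by rewrite ler_wpM2l// ltW.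
lra.
Qed.

Lemma is_derive_dominating (x : R) : b != 0 -> c != 0 -> 0 < x ->
  is_derive x 1 (fun x => alpha x `^ b / (tau * b) - expR (- (c * x)) / c)
    (alpha x `^ (b - 1) * expR (- (tau * x)) + expR (- (c * x))).
Proof.
move=> b0 c0 x0.
have H1 := is_derive_powR_alpha b x0; have H2 := is_derive_expRN c x.
rewrite (_ : (fun x => _) = ((tau * b)^-1 \*: (fun x => alpha x `^ b)) -
   (c^-1 \*: (fun x : R => expR (- (c * x))))); last first.
  by apply/funext => y; rewrite mulrC [X in _ - X]mulrC.
by apply: is_derive_eq; rewrite /GRing.scale/=; field; rewrite c0 b0 gt_eqF.
Qed.

(** On each segment the primitive of the majorant increases by at most 1/(tau b) + 1/c, a bound that
    survives in the limit over the segments. *)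
Lemma integral_wt_lty : 0 < b -> 0 < c ->
  (\int[mu]_(x in `[0%R, +oo[) (wt x)%:E < +oo)%E.
Proof.
move=> b0 c0; have arith (x y u v p q : R) : x <= p -> 0 <= y -> u <= q ->
  0 <= v -> x - v - (y - u) <= p + q by lra.
set C : R := 1 + 2 + 2^-1 `^ (b - 1).
have C0 : 0 <= C by rewrite addr_ge0 ?powR_ge0.
apply: (@le_lt_trans _ _ (C * ((tau * b)^-1 + c^-1))%:E); last exact: ltry.
apply: (cvge_to_le integral_wt_segs) => //; near=> n.
rewrite /seg; have [s0 st] := seg_bounds n.
set s : R := n.+2%:R^-1 in s0 st *; set t : R := n.+2%:R in st *.
have t0 := lt_trans s0 st.
pose f (x : R) := alpha x `^ (b - 1) * expR (- (tau * x)) + expR (- (c * x)).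
have cf (x : R) : 0 < x -> {for x, continuous f}.
  move=> x0; apply: continuousD; last exact: continuous_expRN.
  apply: continuousM; last exact: continuous_expRN.
  have [+ _] := is_derive_powR_alpha (b - 1) x0.
  by move=> /derivable1_diffP/differentiable_continuous.
have FTC := @FTC_segment R f _ s t s0 st
  (fun x x0 => is_derive_dominating (lt0r_neq0 b0) (lt0r_neq0 c0) x0) cf.
have mcf : measurable_fun `[s, t] f.
  apply: (measurable_funS (measurable_itv `]0, +oo[)).
    by move=> x /=; rewrite !in_itv/= andbT => /andP[sx _]; exact: lt_le_trans sx.
  apply: open_continuous_measurable_fun => // x.
  by rewrite inE/= in_itv/= andbT; exact: cf.
apply: (@le_trans _ _ (\int[mu]_(x in `[s, t]) (C * f x)%:E)%E).
  apply: ge0_le_integral => //.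
  - by move=> x _; rewrite lee_fin wt_ge0.
  - by apply/measurable_funTS/measurableT_comp => //; exact: measurable_wt.
  - by apply/measurable_EFinP; apply: measurable_funM.
  - move=> x; rewrite /= in_itv/= => /andP[sx _]; rewrite lee_fin.
    by apply: wt_le => //; exact: lt_le_trans sx.
under eq_integral do rewrite EFinM.
rewrite ge0_integralZl//; last 2 first.
- by apply/measurable_EFinP.
- by move=> x _; rewrite ?lee_fin addr_ge0 ?mulr_ge0 ?powR_ge0 ?expR_ge0.
rewrite FTC -EFinM lee_fin ler_wpM2l//.
have a1 : alpha t `^ b / (tau * b) <= (tau * b)^-1.
  rewrite ler_pdivrMr ?mulr_gt0// mulVf ?gt_eqF ?mulr_gt0//.
  rewrite -(powRr0 (alpha t)); apply: ger_powR; last exact: ltW.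
  by rewrite alpha_gt0// ltW// alpha_lt1.
have a2 : 0 <= alpha s `^ b / (tau * b) by rewrite divr_ge0 ?powR_ge0// mulr_ge0 ?ltW.
have e1 : expR (- (c * s)) / c <= c^-1.
  rewrite ler_pdivrMr// mulVf ?gt_eqF//.
  by rewrite -expR0 ler_expR oppr_le0 mulr_ge0// ltW.
have e2 : 0 <= expR (- (c * t)) / c by rewrite divr_ge0 ?expR_ge0// ltW.
exact: arith a1 a2 e1 e2.
Unshelve. all: end_near. Qed.

Lemma alpha_homo x y : x <= y -> alpha x <= alpha y.
Proof. by move=> xy; rewrite /alpha lerB// ler_expR lerN2 ler_pM2l. Qed.

Lemma integral_wt_gt0 : 0 < c -> (0 < \int[mu]_(x in `[0%R, +oo[) (wt x)%:E)%E.
Proof.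
move=> c0.
(* A lower bound for the weight on [1, 2]; the minimum with 1 covers both signs of b - 1. *)
pose k := Num.min (alpha 1 `^ (b - 1)) 1 * expR (- (c * 2)).
have k0 : 0 < k by rewrite mulr_gt0 ?expR_gt0// lt_min powR_gt0 ?alpha_gt0//= ltr01.
apply: (@lt_le_trans _ _ (\int[mu]_(x in `[1%R, 2%R]) k%:E)%E).
  rewrite integral_cst//= lebesgue_measure_itv/= lte_fin ltr1n.
  by rewrite -EFinD -EFinM lte_fin mulr_gt0// subr_gt0 ltr1n.
apply: (@le_trans _ _ (\int[mu]_(x in `[1%R, 2%R]) (wt x)%:E)%E); last first.
  apply: ge0_subset_integral => //.
  - by apply/measurable_funTS/measurableT_comp => //; exact: measurable_wt.
  - by move=> x _; rewrite lee_fin wt_ge0.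
  - by move=> x; rewrite /= !in_itv/= => /andP[x1 _]; rewrite andbT (le_trans _ x1).
apply: ge0_le_integral => //.
- by move=> x _; rewrite lee_fin ltW.
- by apply/measurable_funTS/measurableT_comp => //; exact: measurable_wt.
- move=> x; rewrite /= in_itv/= => /andP[x1 x2]; rewrite lee_fin.
  have x0 : 0 < x by exact: lt_le_trans x1.
  rewrite /k /wt; apply: ler_pM; rewrite ?expR_ge0//; first by rewrite le_min powR_ge0 ler01.
    rewrite ge_min; have [b1|b1] := leP 0 (b - 1).
      by rewrite ge0_ler_powR ?nnegrE ?alpha_ge0 ?(ltW x0)// alpha_homo.
    have : alpha x `^ 0 <= alpha x `^ (b - 1).
      by apply: ger_powR (ltW b1); rewrite alpha_gt0//= ltW// alpha_lt1.
    by rewrite powRr0 => ->; rewrite orbT.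
  by rewrite ler_expR lerN2 ler_pM2l.
Qed.

(** For b = 0 the weight behaves like 1/(tau x) near 0, and the divergence is logarithmic. *)
Lemma integral_wt_pinfty : b = 0 -> 0 < c ->
  (\int[mu]_(x in `[0%R, +oo[) (wt x)%:E = +oo)%E.
Proof.
move=> b0 c0; apply/eqP; rewrite -leye_eq leNgt; apply/negP => lty.
have ge0 : (0 <= \int[mu]_(x in `[0%R, +oo[) (wt x)%:E)%E.
  by apply: integral_ge0 => x _; rewrite lee_fin wt_ge0.
have finI : (\int[mu]_(x in `[0%R, +oo[) (wt x)%:E)%E \is a fin_num.
  by rewrite ge0_fin_numE.
set I := fine (\int[mu]_(x in `[0%R, +oo[) (wt x)%:E)%E.
(* On (0, 1] one has e^(-c x) >= e^(-c), so the weight dominates the derivative of K ln(alpha),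
   whose increment from s to 1 is unbounded as s tends to 0. *)
pose K := expR (- c) / tau.
have K0 : 0 < K by rewrite divr_gt0 ?expR_gt0.
pose f (x : R) := K * (tau * expR (- (tau * x)) / alpha x).
have dF (x : R) : 0 < x -> is_derive x 1 (fun x => K * ln (alpha x)) (f x).
  move=> x0; have H1 := is_derive_alpha x; have H2 := is_derive1_ln (alpha_gt0 x0).
  have H := @is_derive1_comp _ (@ln R) alpha x _ _ H2 H1.
  rewrite (_ : (fun x => _) = K \*: (fun x => ln (alpha x)))//.
  by apply: is_derive_eq; rewrite /GRing.scale/= /f [X in _ = _ * X]mulrC.
have cf (x : R) : 0 < x -> {for x, continuous f}.
  move=> x0; apply: continuousM; first exact: cst_continuous.
  apply: continuousM.
    apply: continuousM; first exact: cst_continuous.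
    exact: continuous_expRN.
  apply: continuousV; first by rewrite gt_eqF// alpha_gt0.
  have [+ _] := is_derive_alpha x.
  by move=> /derivable1_diffP/differentiable_continuous.
have bound (s : R) : 0 < s -> s < 1 -> K * ln (alpha 1) - K * ln (alpha s) <= I.
  move=> s0 s1; rewrite -lee_fin /I fineK// -(FTC_segment s0 s1 dF cf).
  apply: (@le_trans _ _ (\int[mu]_(x in `[s, 1%R]) (wt x)%:E)%E); last first.
    apply: ge0_subset_integral => //.
    - by apply/measurable_funTS/measurableT_comp => //; exact: measurable_wt.
    - by move=> x _; rewrite lee_fin wt_ge0.
    - move=> x; rewrite /= !in_itv/= => /andP[sx _].
      by rewrite andbT (le_trans _ sx)// ltW.
  apply: ge0_le_integral => //.
  - move=> x; rewrite /= in_itv/= => /andP[sx _]; have x0 := lt_le_trans s0 sx.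
    rewrite lee_fin mulr_ge0 ?(ltW K0)// divr_ge0 ?mulr_ge0 ?expR_ge0 ?(ltW tau0)//.
    by rewrite ltW// alpha_gt0.
  - apply/measurable_EFinP.
    apply: (measurable_funS (measurable_itv `]0, +oo[)).
      by move=> x /=; rewrite !in_itv/= andbT => /andP[sx _]; exact: lt_le_trans sx.
    apply: open_continuous_measurable_fun => // x.
    by rewrite inE/= in_itv/= andbT; exact: cf.
  - by apply/measurable_funTS/measurableT_comp => //; exact: measurable_wt.
  - move=> x; rewrite /= in_itv/= => /andP[sx x1]; have x0 := lt_le_trans s0 sx.
    rewrite lee_fin /wt /f /K b0 sub0r powR_inv1 ?alpha_ge0 ?(ltW x0)//.
    rewrite (_ : _ * _ = expR (- c) * expR (- (tau * x)) / alpha x); last first.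
      by field; rewrite !gt_eqF ?alpha_gt0.
    rewrite [leRHS]mulrC ler_wpM2r ?invr_ge0 ?alpha_ge0 ?(ltW x0)//.
    rewrite -expRD ler_expR; have : 0 < tau * x by rewrite mulr_gt0.
    have : c * x <= c by rewrite ger_pMr.
    lra.
(* If K ln(alpha(s)) <= y, the increment is at least I + K, which exceeds the bound I. Such an [s]
   is found from alpha(s) <= tau s. *)
pose y := K * ln (alpha 1) - I - K.
pose s := Num.min (expR (y / K) / tau) 2^-1.
have s0 : 0 < s by rewrite lt_min divr_gt0 ?expR_gt0//= invr_gt0.
have s1 : s < 1 by rewrite gt_min orbC invf_lt1 ?ltr1n.
have as_ : ln (alpha s) <= y / K.
  rewrite -[leRHS]expRK ler_ln ?posrE ?expR_gt0 ?alpha_gt0//.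
  rewrite (le_trans (alpha_le _))// mulrC -ler_pdivlMr//.
  by rewrite ge_min lexx.
have := bound s s0 s1.
have : K * ln (alpha s) <= y.
  by rewrite mulrC -ler_pdivlMr.
rewrite /y; lra.
Qed.

End weight.

(** * The normalising constant as a Beta integral *)

Section beta_substitution.
Context {R : realType}.
Local Notation mu := (@lebesgue_measure R).

(** Substitution u = e^(-tau x) on compact segments, then monotone convergence on both sides. The
    identity holds in the extended reals and therefore covers divergent integrals, such as those met
    when k = 0. *)
Lemma Beta_wt (tau a b c : R) : 0 < tau -> c = tau * a ->
  Beta a b = (tau%:E * \int[mu]_(x in `[0%R, +oo[) (wt tau b c x)%:E)%E.
Proof.
move=> tau0 cE.
pose F (x : R) := expR (- (tau * x)).
pose G (u : R) := u `^ (a - 1) * (1 - u) `^ (b - 1).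
have decF : {homo F : x y /~ x < y}.
  by move=> x y xy; rewrite ltr_expR ltrN2 ltr_pM2l.
have dF (x : R) : is_derive x 1 F (- tau * F x) by exact: is_derive_expRN.
have cF : continuous F by exact: continuous_expRN.
have F'E : (F^`())%classic = (fun x => - tau * F x).
  by apply/funext => x; rewrite derive1E; have [_ ->] := dF x.
have cF' : continuous (F^`())%classic.
  by rewrite F'E => x; apply: cvgMl_tmp; exact: cF.
have cG (u : R) : 0 < u -> u < 1 -> {for u, continuous G}.
  move=> u0 u1; apply: continuousM.
    have [+ _] := is_derive1_powR (a - 1) u0.
    by move=> /derivable1_diffP/differentiable_continuous.
  have v0 : 0 < 1 - u by rewrite subr_gt0.
  apply: (@continuous_comp _ _ _ (fun u : R => 1 - u) (fun v => v `^ (b - 1))).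
    by apply: cvgB; [exact: cvg_cst|exact: cvg_id].
  have [+ _] := is_derive1_powR (b - 1) v0.
  by move=> /derivable1_diffP/differentiable_continuous.
have F01 (x : R) : 0 < x -> 0 < F x < 1.
  by move=> x0; rewrite expR_gt0 -expR0 ltr_expR oppr_lt0 mulr_gt0.
have mG : measurable_fun setT G.
  apply: measurable_funM; first exact: measurable_powR.
  apply: (measurableT_comp (measurable_powR (b - 1))).
  by apply: measurable_funB.
(* The image of [seg n] under the decreasing substitution, hence the exchanged endpoints. *)
pose U n : set R := `[F n.+2%:R, F n.+2%:R^-1]%classic.
have bigcupU : \bigcup_n U n = `]0, 1[%classic.
  apply/seteqP; split => u.
    move=> [n _]; rewrite /U/= !in_itv/= => /andP[u1 u2].
    have [s0 st] := seg_bounds (R := R) n; have t0 := lt_trans s0 st.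
    have /andP[h1 _] := F01 _ t0; have /andP[_ h2] := F01 _ s0.
    by rewrite (lt_le_trans h1 u1) (le_lt_trans u2 h2).
  rewrite /= in_itv/= => /andP[u0 u1].
  have x0 : 0 < - ln u / tau by rewrite divr_gt0// oppr_gt0 ln_lt0// u0 u1.
  have : (\bigcup_n seg n) (- ln u / tau) by rewrite bigcup_seg/= in_itv/= x0.
  move=> [n _]; rewrite /seg/= in_itv/= => /andP[sx xt].
  exists n => //; rewrite /U/= in_itv/=.
  have -> : u = F (- ln u / tau) by rewrite /F mulrC divfK ?gt_eqF// opprK lnK.
  by rewrite /F !ler_expR !lerN2 !ler_pM2l// sx xt.
have ndU : nondecreasing_seq U.
  move=> m n mn; rewrite subsetEset => u; rewrite /U/= !in_itv/= => /andP[u1 u2].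
  rewrite (le_trans _ u1) ?(le_trans u2)// ler_expR lerN2 ler_pM2l//.
    by rewrite lef_pV2 ?posrE ?ltr0n// ler_nat.
  by rewrite ler_nat.
have intU n : (\int[mu]_(u in U n) (G u)%:E =
    tau%:E * \int[mu]_(x in seg n) (wt tau b c x)%:E)%E.
  have [s0 st] := seg_bounds (R := R) n; have t0 := lt_trans s0 st.
  rewrite integration_by_substitution_decreasing ?(ltW st)//.
  - rewrite -ge0_integralZl//; last 4 first.
    + exact: measurable_itv.
    + by apply/measurable_funTS/measurableT_comp => //; exact: measurable_wt.
    + by move=> x _; rewrite lee_fin wt_ge0.
    + by rewrite lee_fin ltW.
    apply: eq_integral => x; rewrite inE/= in_itv/= => /andP[sx _].
    rewrite -EFinM; congr EFin.
    rewrite /wt -[LHS]/(G (F x) * - (F^`())%classic x) F'E mulNr opprK /G /alpha -/(F x).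
    have : F x `^ (a - 1) * F x = expR (- (c * x)).
      by rewrite /F -expRM -expRD cE; congr expR; ring.
    by move=> <-; ring.
  - by move=> x y _ _; exact: decF.
  - exact: (cvgP _ (cvg_at_right_filter (cF' _))).
  - exact: (cvgP _ (cvg_at_left_filter (cF' _))).
  - split; first by move=> x _; have [] := dF x.
    + by apply: cvg_at_right_filter; exact: cF.
    + by apply: cvg_at_left_filter; exact: cF.
  - apply: continuous_in_subspaceT => u; rewrite inE/= in_itv/= => /andP[u1 u2].
    have /andP[h1 _] := F01 _ t0; have /andP[_ h2] := F01 _ s0.
    by apply: cG; [exact: lt_le_trans u1|exact: le_lt_trans h2].
have lim1 : (\int[mu]_(u in U n) (G u)%:E @[n --> \oo] --> Beta a b)%E.
  rewrite /Beta -bigcupU; apply: ge0_nondecreasing_set_cvg_integral => //.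
  - by move=> n; exact: measurable_itv.
  - by move=> n; apply/measurable_funTS/measurableT_comp.
  - by move=> n x _; rewrite lee_fin mulr_ge0 ?powR_ge0.
apply: (cvg_unique _ lim1) => //=.
under eq_fun do rewrite intU.
by apply: cvgeZl => //; exact: integral_wt_segs.
Qed.

End beta_substitution.

(** * Integration by parts against the weight on the half-line *)

Section integration_by_parts_weight.
Context {R : realType}.
Local Notation mu := (@lebesgue_measure R).
Variables (tau b c : R).
Hypotheses (tau0 : 0 < tau) (b0 : 0 < b) (c0 : 0 < c).

(* [(alpha * wt)' = logd * wt] on the open half-line *)
Definition logd (y : R) : R := b * tau * expR (- (tau * y)) - c * alpha tau y.

Lemma continuous_alpha : continuous (alpha tau).
Proof.
by move=> x; have [/derivable1_diffP/differentiable_continuous] := is_derive_alpha tau x.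
Qed.

Lemma continuous_logd : continuous logd.
Proof.
move=> x; apply: cvgB; apply: cvgMl_tmp; [exact: continuous_expRN|].
exact: continuous_alpha.
Qed.


Lemma bounded_compact_support (g : R -> R) (M : R) : continuous g ->
  (forall y, M < y -> g y = 0) ->
  exists C : R, 0 < C /\ forall y, 0 <= y -> `|g y| <= C.
Proof.
move=> cg g0.
have cK : compact (g @` `[0, M]).
  apply: continuous_compact; last exact: segment_compact.
  exact: continuous_subspaceT.
have /compact_bounded[B [_ HB]] := cK.
exists (`|B| + 1); split => [|y y0]; first by rewrite ltr_wpDl.
have [yM|yM] := leP y M.
  apply: HB; first by rewrite (le_lt_trans (ler_norm _))// ltrDl.
  by exists y => //=; rewrite in_itv/= y0.
by rewrite g0// normr0 addr_ge0.
Qed.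

(** Since alpha(s) <= tau s, it is enough that tau s <= e^(1/b) at s = 1/(n+2). Here b > 0 makes the
    boundary term at 0 disappear. *)
Lemma powR_alpha_cvg0 (e : R) : 0 < e ->
  \forall n \near \oo, alpha tau n.+2%:R^-1 `^ b <= e.
Proof.
move=> e0; near=> n.
have [s0 _] := seg_bounds (R := R) n.
rewrite (@le_trans _ _ ((e `^ b^-1) `^ b))//; last first.
  by rewrite -powRrM mulVf ?gt_eqF// powRr1// ltW.
apply: ge0_ler_powR; rewrite ?nnegrE ?powR_ge0 ?(ltW b0)//.
  by rewrite ltW// alpha_gt0.
rewrite (le_trans (alpha_le _ _))// ler_pdivrMr ?ltr0n//.
rewrite -ler_pdivrMl ?powR_gt0//.
near: n; exists (Num.truncn ((e `^ b^-1)^-1 * tau)) => // n /= hn.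
have h : 0 <= (e `^ b^-1)^-1 * tau by rewrite mulr_ge0 ?invr_ge0 ?powR_ge0// ltW.
have /andP[_ /ltW/le_trans] := truncn_itv h; apply.
by rewrite ler_nat ltnS leqW.
Unshelve. all: end_near. Qed.

Variables (phi dphi : R -> R) (M : R).
Hypothesis dphiE : forall y : R, is_derive y 1 phi (dphi y).
Hypothesis cdphi : continuous dphi.
Hypothesis phi0 : forall y, M < y -> phi y = 0.

Let cphi : continuous phi.
Proof. by move=> x; have [/derivable1_diffP/differentiable_continuous] := dphiE x. Qed.

Let dphi0 y : M < y -> dphi y = 0.
Proof.
move=> My; have H : is_derive y 1 phi 0.
  apply: (@near_eq_is_derive _ _ _ (cst 0)).
  by near=> z; rewrite phi0//; near: z; exact: lt_nbhsr.
by have [_ <-] := dphiE y; have [_ ->] := H.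
Unshelve. all: end_near. Qed.

Let g y := alpha tau y * dphi y + logd y * phi y.

Let cg : continuous g.
Proof.
move=> x; apply: cvgD; apply: cvgM; [exact: continuous_alpha|exact: cdphi|
  exact: continuous_logd|exact: cphi].
Qed.

Lemma integrable_ibp_wt :
  mu.-integrable `[0, +oo[ (EFin \o (fun y => g y * wt tau b c y)).
Proof.
have [C [C0 gC]] : exists C : R, 0 < C /\ forall y, 0 <= y -> `|g y| <= C.
  apply: (@bounded_compact_support g M cg) => y My.
  by rewrite /g phi0// dphi0// !mulr0 addr0.
have Iw : mu.-integrable `[0, +oo[ (EFin \o (fun y => C * wt tau b c y)).
  rewrite (_ : _ \o _ = (fun y => C%:E * (wt tau b c y)%:E)%E)//.
  apply: integrableZl => //; apply/integrableP; split.
    by apply/measurable_funTS/measurableT_comp => //; exact: measurable_wt.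
  under eq_integral do rewrite gee0_abs ?lee_fin ?wt_ge0//.
  exact: integral_wt_lty.
apply: (le_integrable _ _ _ Iw) => //.
  apply/measurable_funTS/measurableT_comp => //; apply: measurable_funM.
    exact: continuous_measurable_fun.
  exact: measurable_wt.
move=> y; rewrite /= in_itv/= andbT => y0.
rewrite lee_fin normrM [leRHS]normrM (ger0_norm (wt_ge0 _ _ _ _)) (gtr0_norm C0).
by rewrite ler_wpM2r ?wt_ge0// gC.
Qed.

Lemma integral_ibp_wt :
  (\int[mu]_(y in `[0%R, +oo[) (g y * wt tau b c y)%:E = 0)%E.
Proof.
pose f y := g y * wt tau b c y.
(* This is alpha times [wt] times [phi], with the powers of alpha merged. The exponent b > 0 makes
   it tend to 0 at the origin even where [wt] blows up; at the right end [phi] vanishes. *)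
pose h y := alpha tau y `^ b * (expR (- (c * y)) * phi y).
have mf : measurable_fun setT f.
  by apply: measurable_funM; [exact: continuous_measurable_fun|exact: measurable_wt].
have dh (y : R) : 0 < y -> is_derive y 1 h (f y).
  move=> y0; have H1 := is_derive_powR_alpha tau0 b y0.
  have H2 := is_derive_expRN c y; have H3 := dphiE y.
  rewrite (_ : h = (fun y => alpha tau y `^ b) *
    ((fun y : R => expR (- (c * y))) * phi))//.
  apply: is_derive_eq; rewrite /GRing.scale/= /f /g /wt /logd.
  (* Splitting alpha^b as alpha alpha^(b-1) brings out [wt] as a common factor. *)
  rewrite -(mulr_powRB1 (ltW (alpha_gt0 tau0 y0)) b0) !fctE/=; ring.
have cf (y : R) : 0 < y -> {for y, continuous f}.
  by move=> y0; apply: cvgM; [exact: cg|exact: continuous_wt].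
rewrite -integral_itv_obnd_cbnd; last first.
  by apply/measurable_funTS/measurableT_comp.
rewrite -bigcup_seg.
have lim : (\int[mu]_(y in seg n) (f y)%:E @[n --> \oo] -->
    \int[mu]_(y in \bigcup_n seg n) (f y)%:E)%E.
  apply: cvg_integral_bigcup; first exact: nondecreasing_seg.
    by move=> n; exact: measurable_itv.
  rewrite bigcup_seg; apply: (integrableS _ _ _ integrable_ibp_wt) => //.
  by move=> y; rewrite /= !in_itv/= !andbT => /ltW.
apply: (cvg_unique _ lim) => //.
have [B [B0 phiB]] := bounded_compact_support cphi phi0.
apply: cvg_EFin; first by near=> n; rewrite FTC_segment//; have [] := seg_bounds (R := R) n.
apply/cvgr0Pnorm_le => e e0; near=> n.
have [s0 st] := seg_bounds (R := R) n.
rewrite /= (FTC_segment s0 st dh cf)/= {1}/h phi0; last first.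
  near: n; exists (Num.truncn `|M|) => // n /= hn.
  rewrite (le_lt_trans (ler_norm _))//.
  have /andP[_ /lt_le_trans] := truncn_itv (normr_ge0 M); apply.
  by rewrite ler_nat ltnS leqW.
rewrite !mulr0 sub0r normrN /h normrM (ger0_norm (powR_ge0 _ _)).
apply: (@le_trans _ _ (e / B * B)); last by rewrite divfK ?gt_eqF.
apply: ler_pM => //; first exact: powR_ge0.
  by near: n; apply: powR_alpha_cvg0; rewrite divr_gt0.
rewrite normrM (ger0_norm (expR_ge0 _)) -[leRHS]mul1r ler_pM ?expR_ge0//.
  by rewrite -expR0 ler_expR oppr_le0 mulr_ge0// ltW.
by apply: phiB; exact: ltW.
Unshelve. all: end_near. Qed.

End integration_by_parts_weight.

(** * Marginals *)

Section density_measure.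
Context d (T : measurableType d) (R : realType).
Variables (mu : {sigma_finite_measure set T -> \bar R}) (g : T -> \bar R).
Local Open Scope ereal_scope.
Hypotheses (g0 : forall x, 0 <= g x) (mg : measurable_fun setT g).

Definition density (A : set T) : \bar R := \int[mu]_(x in A) g x.

Let density0 : density set0 = 0.
Proof. by rewrite /density integral_set0. Qed.

Let density_ge0 A : 0 <= density A.
Proof. by apply: integral_ge0 => x _. Qed.

Let density_sigma_additive : semi_sigma_additive density.
Proof.
move=> /= F mF tF mUF; rewrite /density; apply: cvg_toP.
  apply: ereal_nondecreasing_is_cvgn => m n mn.
  by apply: lee_sum_nneg_natr => // k _ _; exact: integral_ge0.
by rewrite ge0_integral_bigcup//; exact: measurable_funTS.
Qed.

HB.instance Definition _ := isMeasure.Build _ _ _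
  density density0 density_ge0 density_sigma_additive.

(** Applied later to a transition probability x |-> P_t(x, B) as density, to see the flow from A
    into B as a measure in A. *)
Lemma exists_density_measure : exists nu : {measure set T -> \bar R},
  forall A, nu A = \int[mu]_(x in A) g x.
Proof. by exists density. Qed.

Hypothesis g1 : \int[mu]_x g x = 1.

Let density_setT : density setT = 1. Proof. exact: g1. Qed.

HB.instance Definition _ := Measure_isProbability.Build _ _ _ density density_setT.

Let density_dom : density `<< mu.
Proof.
apply/null_content_dominatesP => A mA muA0.
by apply: null_set_integral => //; exact: measurable_funTS.
Qed.

(** Both [g] and the Radon-Nikodym derivative integrate to [density] on measurable sets, so they
    agree almost everywhere and the change of variables formula applies to [g]. *)
Lemma integral_density (f : T -> \bar R) : density.-integrable setT f ->
  \int[density]_x f x = \int[mu]_x (f x * g x).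
Proof.
move=> fi; have mf := measurable_int _ fi.
have gi : mu.-integrable setT g.
  apply/integrableP; split => //.
  under eq_integral do rewrite gee0_abs//.
  by rewrite g1 ltry.
rewrite -(Radon_Nikodym_change_of_variables density_dom)//=.
apply: ae_eq_integral => //.
- exact: emeasurable_funM.
- exact: emeasurable_funM.
- apply: ae_eqe_mul2l => /=.
  rewrite Radon_NikodymE//=; case: cid => /= h [h1 h2 h3].
  apply: integral_ae_eq => //=.
  by move=> E _ mE; rewrite -h3.
Qed.

Lemma exists_density_probability : exists P : probability T R,
  (forall A, P A = \int[mu]_(x in A) g x) /\
  (forall f, P.-integrable setT f -> \int[P]_x f x = \int[mu]_x (f x * g x)).
Proof. by exists density; split => // f; exact: integral_density. Qed.

End density_measure.

(** * The single-site probability laws and their integration by parts formula *)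

Section marginals.
Context {R : realType}.
Variables (sigma k gamma : R) (i : nat).
Hypotheses (hsigma : 0 < sigma) (hgamma : - (4 * sigma * k) < gamma).
Local Notation RM := (measurableTypeR R).
Local Notation mu := (@lebesgue_measure R).
Local Notation tau := (2 * sigma).
Local Notation b := (2 * k).
Local Notation c := (4 * sigma * k * i.+1%:R + gamma).

Let tau0 : 0 < tau. Proof. by rewrite mulr_gt0. Qed.

(** Sites are numbered from 1, so the rate is at least 4 sigma k + gamma; this is where the range of
    [gamma] comes from. *)
Lemma rate_gt0 : 0 <= k -> 0 < c.
Proof.
move=> hk; rewrite -[i.+1%:R]natr1 mulrDr mulr1.
have : 0 <= 4 * sigma * k * i%:R by rewrite !mulr_ge0// ltW.
have := hgamma; lra.
Qed.

Lemma abep_ZE : abep_Z sigma k gamma i.+1 =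
  (\int[mu]_(x in `[0%R, +oo[) (wt tau b c x)%:E)%E.
Proof.
rewrite /abep_Z (@Beta_wt _ tau _ _ c)//; last first.
  by field; rewrite gt_eqF.
by rewrite muleA -EFinM mulVf ?gt_eqF// mul1e.
Qed.

Lemma abep_Z_pinfty : k = 0 -> abep_Z sigma k gamma i.+1 = +oo%E.
Proof.
move=> k0; rewrite abep_ZE integral_wt_pinfty//; first by rewrite k0 mulr0.
by apply: rate_gt0; rewrite k0.
Qed.

(** In the last clause [F] is prescribed on the half-line only, because it will be a function of a
    clamped coordinate; on negative reals it just has to be measurable and bounded. *)
Lemma exists_marginal : 0 < k -> exists P : probability RM R,
  [/\ forall A : set R, measurable A -> P A = abep_marginal sigma k gamma i.+1 A,
      P `[0, +oo[%classic = 1%E &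
      forall (phi dphi F : R -> R) (M N : R),
        (forall y : R, is_derive y 1 phi (dphi y)) -> continuous dphi ->
        (forall y, M < y -> phi y = 0) ->
        measurable_fun setT F -> (forall y, `|F y| <= N) ->
        (forall y, 0 <= y -> F y = alpha tau y * dphi y + logd tau b c y * phi y) ->
        (\int[P]_y (F y)%:E = 0)%E].
Proof.
move=> k0; have c0 := rate_gt0 (ltW k0).
have b0 : 0 < b by rewrite mulr_gt0.
pose Z := (\int[mu]_(x in `[0%R, +oo[) (wt tau b c x)%:E)%E.
have Z0 : (0 < Z)%E by exact: integral_wt_gt0.
have Zfin : Z \is a fin_num.
  by rewrite ge0_fin_numE ?(ltW Z0)//; exact: integral_wt_lty.
pose z := fine Z.
have zE : Z = z%:E by rewrite /z fineK.
have z0 : 0 < z by rewrite -lte_fin -zE.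
pose g : R -> R := (fun y => z^-1 * wt tau b c y) \_ `[0, +oo[.
have g_ge0 y : 0 <= g y.
  by rewrite /g patchE; case: ifP => // _; rewrite mulr_ge0 ?wt_ge0// invr_ge0 ltW.
have mwz : measurable_fun setT (fun y => z^-1 * wt tau b c y).
  by apply: measurable_funM => //; exact: measurable_wt.
have mg : measurable_fun setT g.
  by apply/(measurable_restrictT _ _).1; [|exact: measurable_funTS].
have gE A (f : R -> \bar R) : measurable A ->
    (\int[mu]_(y in A) (f y * (g y)%:E) =
     \int[mu]_(y in A `&` `[0%R, +oo[) (f y * (z^-1 * wt tau b c y)%:E))%E.
  move=> mA; rewrite integral_mkcondr; apply: eq_integral => y _.
  by rewrite /g !patchE; case: ifP; rewrite ?mule0.
have g1 : (\int[mu]_y (g y)%:E = 1)%E.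
  under eq_integral do rewrite -[(g _)%:E]mul1e.
  rewrite (gE setT (cst 1%E))// setTI.
  under eq_integral do rewrite mul1e EFinM.
  rewrite ge0_integralZl//.
  - by rewrite -/Z zE -EFinM mulVf ?gt_eqF.
  - by apply/measurable_funTS/measurableT_comp => //; exact: measurable_wt.
  - by move=> y _; rewrite lee_fin wt_ge0.
  - by rewrite lee_fin invr_ge0 ltW.
have g_ge0' y : (0 <= (g y)%:E)%E by rewrite lee_fin.
have mEg : measurable_fun setT (EFin \o g) by exact/measurable_EFinP.
have [P [PE PI]] := exists_density_probability (mu := mu) g_ge0' mEg g1.
have PA (A : set R) : measurable A -> P A = abep_marginal sigma k gamma i.+1 A.
  move=> mA; rewrite PE /abep_marginal.
  under eq_integral do rewrite -[(g _)%:E]mul1e.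
  rewrite (gE A (cst 1%E))//; apply: eq_integral => y _.
  by rewrite mul1e /abep_density abep_ZE -/Z zE EFinM inver gt_eqF.
exists P; split => //.
  rewrite PA// -[RHS](probability_setT P) PA//.
  by rewrite /abep_marginal setIid setTI.
move=> phi dphi F M N dphiE cdphi phi0 mF FN FE.
rewrite PI; last first.
  apply: measurable_bounded_integrable => //.
    exact: fin_num_fun_lty.
  exists N; split; first by rewrite num_real.
  by move=> r Nr y _; rewrite /= (le_trans (FN y))// ltW.
rewrite (gE setT (fun y => (F y)%:E))// setTI.
under eq_integral => y.
  rewrite inE/= in_itv/= andbT => y0.
  rewrite FE// -EFinM mulrCA EFinM.
  over.
rewrite integralZl//.
  by rewrite (integral_ibp_wt tau0 b0 c0 dphiE cdphi phi0) mule0.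
exact: (integrable_ibp_wt tau0 b0 c0 dphiE cdphi phi0).
Qed.

End marginals.

(** * Integration by parts on the orthant *)

Section C1_functions.
Context {R : realType} {L : nat}.
Local Notation V := 'rV[R]_L.
Implicit Types F G : V -> R.

Definition C1 F := (forall x, differentiable F x) /\
  forall l, continuous (partial l F).

Lemma smooth_partial F l : smooth F -> smooth (partial l F).
Proof. by move=> sF s x; have := sF (rcons s l) x; rewrite foldr_rcons. Qed.

Lemma smooth_C1 F : smooth F -> C1 F.
Proof.
move=> sF; split => [x|l x]; first exact: (sF [::]).
exact/differentiable_continuous/(sF [:: l]).
Qed.

Lemma C1_continuous F : C1 F -> continuous F.
Proof. by move=> [dF _] x; exact/differentiable_continuous/dF. Qed.

Lemma partialB F G l : C1 F -> C1 G ->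
  partial l (fun x => F x - G x) = fun x => partial l F x - partial l G x.
Proof.
move=> [dF _] [dG _]; apply/funext => x; rewrite /partial.
by rewrite (@deriveB _ _ _ F G)//; exact: diff_derivable.
Qed.

Lemma partialM F G l : C1 F -> C1 G ->
  partial l (fun x => F x * G x) = fun x => F x * partial l G x + G x * partial l F x.
Proof.
move=> [dF _] [dG _]; apply/funext => x; rewrite /partial.
by rewrite (@deriveM _ _ F G)//; exact: diff_derivable.
Qed.

Lemma C1B F G : C1 F -> C1 G -> C1 (fun x => F x - G x).
Proof.
move=> CF CG; have [dF cF] := CF; have [dG cG] := CG; split => [x|l].
  exact: (@differentiableB _ _ _ F G).
rewrite partialB// => x; apply: (@continuousB _ _ _ (partial l F) (partial l G)).
  exact: cF.
exact: cG.
Qed.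

Lemma C1M F G : C1 F -> C1 G -> C1 (fun x => F x * G x).
Proof.
move=> CF CG; have [dF cF] := CF; have [dG cG] := CG; split => [x|l].
  exact: (@differentiableM _ _ F G).
rewrite partialM// => x.
apply: (@continuousD _ _ _ (fun x => F x * partial l G x) (fun x => G x * partial l F x)).
  by apply: (@continuousM _ _ F (partial l G)); [exact: C1_continuous|exact: cG].
by apply: (@continuousM _ _ G (partial l F)); [exact: C1_continuous|exact: cF].
Qed.

(** Contrary to [resample] there is no clamp, so functions can be differentiated along the whole
    line. Both agree for y >= 0 at points of the orthant. *)
Definition line (x : V) (i : 'I_L) (y : R) : V :=
  \row_j if j == i then y else x ord0 j.

Lemma line_id x i : line x i (x ord0 i) = x.
Proof. by apply/rowP => j; rewrite mxE; case: eqP => // ->. Qed.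

Lemma continuous_line x i : continuous (line x i).
Proof.
move=> y A [P Py PA] /=.
have : \forall z \near y, forall j, P ord0 j (line x i z ord0 j).
  apply: (@filter_forall _ _ (fun j z => P ord0 j (line x i z ord0 j)) _
    (nbhs_filter y)) => j.
  have := Py ord0 j; rewrite mxE /line.
  have [ji|ji] := eqVneq j i => Pj.
    by apply: filterS Pj => z Pz; rewrite mxE ji eqxx -ji.
  by near=> z; rewrite mxE (negbTE ji); exact: nbhs_singleton.
by apply: filterS => z Pz; apply: PA => r j; rewrite (ord1 r); exact: Pz.
Unshelve. all: end_near. Qed.

Lemma is_derive_line F x i (y : R) : (forall x, differentiable F x) ->
  is_derive y 1 (fun y => F (line x i y)) (partial i F (line x i y)).
Proof.
move=> dF.
have E : (fun h : R => h^-1 *: (((fun y => F (line x i y)) \o shift y) (h *: 1)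
      - F (line x i y))) =
   (fun h => h^-1 *: ((F \o shift (line x i y)) (h *: delta_mx ord0 i) -
      F (line x i y))).
  apply/funext => h /=; congr (_ *: (F _ - _)); apply/rowP => j; rewrite !mxE eqxx/=.
  by case: (j == i); rewrite /GRing.scale/= ?mulr0 ?add0r.
have D : derivable F (line x i y) (delta_mx ord0 i) by exact: diff_derivable.
split; first by rewrite /derivable E.
by rewrite /partial /derive E.
Qed.

(** An existing two-sided derivative is computed by its right-hand quotients. This serves at the
    faces of the orthant, where a function is known on one side only. *)
Lemma is_derive_eq0_right (f : R -> R) (y df : R) : is_derive y 1 f df ->
  (forall z, y <= z -> f z = 0) -> df = 0.
Proof.
move=> [fy <-] f0.
have /cvg_dnbhs_at_right lim : h^-1 *: ((f \o shift y) (h *: 1) - f y)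
  @[h --> 0^'] --> 'D_1 f y by exact: fy.
suff : h^-1 *: ((f \o shift y) (h *: 1) - f y) @[h --> 0^'+] --> (0 : R).
  by move=> lim0; exact: (cvg_unique _ lim lim0).
apply: (cvg_near_cst 0); near=> h.
rewrite /= [f y]f0// f0 ?subr0 ?scaler0//.
rewrite lerDr /GRing.scale/= mulr1; near: h; exact: nbhs_right_ge.
Unshelve. all: end_near. Qed.

End C1_functions.
Section continuous_real_functions.
Context {R : realType} {X : topologicalType}.
Implicit Types f g : X -> R.

Lemma continuous_funM f g : continuous f -> continuous g ->
  continuous (fun x => f x * g x).
Proof. by move=> cf cg x; apply: (@cvgM _ _ (nbhs x) _ f g); [exact: cf|exact: cg]. Qed.

Lemma continuous_funD f g : continuous f -> continuous g ->
  continuous (fun x => f x + g x).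
Proof. by move=> cf cg x; apply: (@cvgD _ _ _ (nbhs x) _ f g); [exact: cf|exact: cg]. Qed.

Lemma continuous_funB f g : continuous f -> continuous g ->
  continuous (fun x => f x - g x).
Proof. by move=> cf cg x; apply: (@cvgB _ _ _ (nbhs x) _ f g); [exact: cf|exact: cg]. Qed.

End continuous_real_functions.

Section bounded_functions.
Context {R : realType} {L : nat}.
Local Notation S := (state R L).

Lemma bounded_of_compact_support (f : S -> R) (M : R) : continuous f ->
  (forall x l, M < row_of x ord0 l -> f x = 0) ->
  exists N, forall x, `|f x| <= N.
Proof.
move=> cf f0.
pose K : set S := [set x | forall l, 0 <= row_of x ord0 l <= M].
have cK : compact (f @` K).
  apply: continuous_compact; last first.
    exact: (@compact_closed_box R L (fun=> 0) (fun=> M)).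
  exact: continuous_subspaceT.
have /compact_bounded[B [_ HB]] := cK.
exists (`|B| + 1) => x; have [xK|] := pselect (K x).
  apply: HB; first by rewrite (le_lt_trans (ler_norm _))// ltrDl.
  by exists x.
move=> /existsNP[l]; rewrite row_of_ge0/= => /negP; rewrite -ltNge => Ml.
by rewrite (f0 x l)// normr0 addr_ge0.
Qed.

Lemma integrable_bounded (mu : {measure set S -> \bar R}) (f : S -> R) :
  (mu setT < +oo)%E -> measurable_fun setT f -> (exists N, forall x, `|f x| <= N) ->
  mu.-integrable setT (EFin \o f).
Proof.
move=> muT mf [N fN]; apply: measurable_bounded_integrable => //.
exists N; split; first by rewrite num_real.
by move=> r Nr x _; rewrite /= (le_trans (fN x))// ltW.
Qed.

(** Integrability is carried along with the vanishing so that null integrals can be added and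
    scaled. *)
Definition null_integral (mu : probability S R) (f : S -> R) :=
  mu.-integrable setT (EFin \o f) /\ (\int[mu]_x (f x)%:E = 0)%E.

Lemma null_integral0 mu : null_integral mu (fun=> 0).
Proof. by split; [exact: integrable0|exact: integral0]. Qed.

Lemma null_integralD mu f g : null_integral mu f -> null_integral mu g ->
  null_integral mu (fun x => f x + g x).
Proof.
move=> [fi f0] [gi g0]; split; first exact: (integrableD measurableT fi gi).
under eq_integral do rewrite EFinD.
by rewrite integralD// f0 g0 adde0.
Qed.

Lemma null_integralZ mu (a : R) f : null_integral mu f ->
  null_integral mu (fun x => a * f x).
Proof.
move=> [fi f0]; split; first exact: (integrableZl measurableT a fi).
under eq_integral do rewrite EFinM.
by rewrite integralZl// f0 mule0.
Qed.

Lemma null_integral_sum mu (I : Type) (r : seq I) (p : pred I) (f : I -> S -> R) :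
  (forall i, p i -> null_integral mu (f i)) ->
  null_integral mu (fun x => \sum_(i <- r | p i) f i x).
Proof.
move=> f0; elim: r => [|i r ih].
  by under eq_fun do rewrite big_nil; exact: null_integral0.
under eq_fun do rewrite big_cons.
case pi : (p i) => //.
by apply: null_integralD => //; exact: f0.
Qed.

End bounded_functions.

(** * The two vanishing integrals attached to a bond *)

Section generator_symmetry.
Context {R : realType} {L : nat}.
Variables (sigma k gamma : R).
Local Notation S := (state R L).
Local Notation RM := (measurableTypeR R).
Local Notation tau := (2 * sigma).
Local Notation b := (2 * k).
Local Notation c i := (4 * sigma * k * i.+1%:R + gamma).
Variables (m : 'I_L -> probability RM R) (mu : probability S R).
Hypothesis m1 : forall i, m i `[0, +oo[%classic = 1%E.
Hypothesis muE : is_product_measure mu m.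
Hypothesis m_ibp : forall (i : 'I_L) (phi dphi F : R -> R) (M N : R),
  (forall y : R, is_derive y 1 phi (dphi y)) -> continuous dphi ->
  (forall y, M < y -> phi y = 0) ->
  measurable_fun setT F -> (forall y, `|F y| <= N) ->
  (forall y, 0 <= y -> F y = alpha tau y * dphi y + logd tau b (c i) y * phi y) ->
  (\int[m i]_y (F y)%:E = 0)%E.

Variables (V : 'rV[R]_L -> R) (M : R).
Hypotheses (CV : C1 V) (M0 : 0 <= M).
Hypothesis V0 : forall (x : S) l, M < row_of x ord0 l -> V (row_of x) = 0.

Let dV := CV.1.
Let cdV := CV.2.

Lemma continuous_row_comp (f : 'rV[R]_L -> R) : continuous f ->
  continuous (fun x : S => f (row_of x)).
Proof.
move=> cf x; apply: (@continuous_comp _ _ _ (@row_of R L) f); last exact: cf.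
exact: continuous_row_of.
Qed.

Lemma row_of_line (x : S) i y : 0 <= y -> line (row_of x) i y = row_of (resample i (x, y)).
Proof. by move=> y0; rewrite row_of_resample. Qed.

Let line0 (x : S) i y : M < y -> V (line (row_of x) i y) = 0.
Proof.
move=> My; have y0 : 0 <= y by rewrite ltW// (le_lt_trans M0).
by rewrite row_of_line// (V0 (l := i))// row_of_resample// mxE eqxx.
Qed.

(** The support condition concerns points of the orthant only, so at a face [V] is known to vanish
    just in the inward direction; one-sided vanishing suffices. *)
Let partial0 (x : S) i l : M < row_of x ord0 l -> partial i V (row_of x) = 0.
Proof.
move=> Ml; apply: (@is_derive_eq0_right _ (fun y => V (line (row_of x) i y)) (row_of x ord0 i)).
  by have := is_derive_line (row_of x) i (row_of x ord0 i) dV; rewrite line_id.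
move=> z xz; have z0 : 0 <= z by exact: le_trans (row_of_ge0 _ _) xz.
rewrite row_of_line// (V0 (l := l))// row_of_resample// mxE.
by case: eqP => // li; rewrite (lt_le_trans _ xz)// -li.
Qed.

Let cline (x : S) i : continuous (fun y => partial i V (line (row_of x) i y)).
Proof.
move=> y; apply: (@continuous_comp _ _ _ (line (row_of x) i) (partial i V)).
  exact: continuous_line.
exact: cdV.
Qed.

Lemma continuous_coord_comp (g : R -> R) i : continuous g ->
  continuous (fun x : S => g (row_of x ord0 i)).
Proof.
move=> cg x; apply: (@continuous_comp _ _ _ (fun x : S => row_of x ord0 i) g).
  exact: continuous_coord_state.
exact: cg.
Qed.

Let cexp (d : R) : continuous (fun y : R => expR (d * y)).
Proof.
move=> y; apply: (@continuous_comp _ _ _ (fun y : R => d * y) expR).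
  exact: mulrl_continuous.
exact: continuous_expR.
Qed.

(** Integration by parts in x_i alone: the factor in x_j is constant along the line, and alpha(x_i)
    supplies the zero at the face. *)
Lemma null_integral_bond_l (i : 'I_L) (j : 'I_L) : i != j ->
  null_integral mu (fun x : S => (expR (tau * row_of x ord0 j) - 1) *
    (alpha tau (row_of x ord0 i) * partial i V (row_of x) +
     logd tau b (c i) (row_of x ord0 i) * V (row_of x))).
Proof.
move=> ij; set H := (fun x : S => _ : R).
have cH : continuous H.
  have c1 := continuous_coord_comp (i := j) (@cexp tau).
  have c2 := continuous_coord_comp (i := i) (@continuous_alpha _ tau).
  have c3 := continuous_coord_comp (i := i) (@continuous_logd _ tau b (c i)).
  have c4 := continuous_row_comp (cdV (l := i)).
  have c5 := continuous_row_comp (C1_continuous CV).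
  apply: continuous_funM; first by apply: continuous_funB => //; exact: cst_continuous.
  by apply: continuous_funD; apply: continuous_funM.
have mH : measurable_fun setT H by exact: continuous_measurable_state.
have HN : exists N, forall x, `|H x| <= N.
  apply: (@bounded_of_compact_support _ _ _ M cH) => x l Ml.
  by rewrite /H (V0 Ml) (partial0 i Ml) !mulr0 addr0 mulr0.
split; first by apply: integrable_bounded => //; exact: fin_num_fun_lty.
apply: (integral_resample0 (m := m) (i := i) m1 muE mH HN) => x.
have [N HN'] := HN.
pose e := expR (tau * row_of x ord0 j) - 1.
apply: (@m_ibp i (fun y => e * V (line (row_of x) i y))
  (fun y => e * partial i V (line (row_of x) i y)) _ M N).
- by move=> y; have D := is_derive_line (row_of x) i y dV; exact: (is_deriveZ e D).
- by move=> y; apply: cvgMl_tmp; exact: cline.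
- by move=> y My; rewrite line0// mulr0.
- apply: (@measurable_fun_pair2 _ _ _ _ _ _ (H \o resample i) x).
  by apply: measurableT_comp => //; exact: measurable_resample.
- by move=> y; exact: HN'.
- move=> y y0; rewrite /H row_of_resample// -/(line (row_of x) i y) !mxE eqxx.
  by rewrite eq_sym (negbTE ij) /e; ring.
Qed.

(** Integration by parts in x_j alone. The coefficient e^(tau x_j) - 1 is alpha(x_j) up to the
    factor e^(tau x_j), which lowers the rate from c_j to c_j - tau. *)
Lemma null_integral_bond_r (i : 'I_L) (j : 'I_L) : i != j ->
  null_integral mu (fun x : S => alpha tau (row_of x ord0 i) *
    ((expR (tau * row_of x ord0 j) - 1) * partial j V (row_of x) +
     (b * tau - (c j - tau) * (expR (tau * row_of x ord0 j) - 1)) * V (row_of x))).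
Proof.
move=> ij; set H := (fun x : S => _ : R).
have cH : continuous H.
  have c1 := continuous_coord_comp (i := j) (@cexp tau).
  have c1' : continuous (fun x : S => expR (tau * row_of x ord0 j) - 1).
    by apply: continuous_funB => //; exact: cst_continuous.
  have c2 := continuous_coord_comp (i := i) (@continuous_alpha _ tau).
  have c4 := continuous_row_comp (cdV (l := j)).
  have c5 := continuous_row_comp (C1_continuous CV).
  apply: continuous_funM => //; apply: continuous_funD; first exact: continuous_funM.
  apply: continuous_funM => //; apply: continuous_funB; first exact: cst_continuous.
  by apply: continuous_funM => //; exact: cst_continuous.
have mH : measurable_fun setT H by exact: continuous_measurable_state.
have HN : exists N, forall x, `|H x| <= N.
  apply: (@bounded_of_compact_support _ _ _ M cH) => x l Ml.
  by rewrite /H (V0 Ml) (partial0 j Ml) !mulr0 addr0 mulr0.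
split; first by apply: integrable_bounded => //; exact: fin_num_fun_lty.
apply: (integral_resample0 (m := m) (i := j) m1 muE mH HN) => x.
have [N HN'] := HN.
pose e := alpha tau (row_of x ord0 i).
pose f y := V (line (row_of x) j y).
pose df y := partial j V (line (row_of x) j y).
(* The test function absorbs e^(tau y); multiplied by alpha(y), it gives back e^(tau y) - 1. *)
apply: (@m_ibp j (fun y => e * (expR (tau * y) * f y))
  (fun y => e * (expR (tau * y) * df y + f y * (tau * expR (tau * y)))) _ M N).
- move=> y; have D : is_derive y 1 f (df y) := is_derive_line (row_of x) j y dV.
  have D2 := is_derive_expRN (- tau) y.
  have D3 : is_derive y 1 (fun y : R => expR (tau * y)) (tau * expR (tau * y)).
    move: D2; rewrite opprK mulNr opprK.
    by under [X in is_derive _ _ X _]eq_fun do rewrite mulNr opprK.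
  exact: (is_deriveZ e (is_deriveM D3 D)).
- apply: continuous_funM; first exact: cst_continuous.
  apply: continuous_funD; first by apply: continuous_funM; [exact: cexp|exact: cline].
  apply: continuous_funM => [y|].
    by have [/derivable1_diffP/differentiable_continuous] := is_derive_line (row_of x) j y dV.
  by apply: continuous_funM; [exact: cst_continuous|exact: cexp].
- by move=> y My; rewrite /f line0// !mulr0.
- apply: (@measurable_fun_pair2 _ _ _ _ _ _ (H \o resample j) x).
  by apply: measurableT_comp => //; exact: measurable_resample.
- by move=> y; exact: HN'.
- move=> y y0; rewrite /H row_of_resample// -/(line (row_of x) j y) !mxE eqxx.
  rewrite (negbTE ij) /e -/(f y) -/(df y) /logd /alpha.
  rewrite !expRN /GRing.scale/=; field.
  by rewrite !gt_eqF ?expR_gt0.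
Qed.

End generator_symmetry.

Section abep_symmetry.
Context {R : realType} {L : nat}.
Variables (sigma k gamma : R).
Hypotheses (hsigma : 0 < sigma).
Local Notation S := (state R L).
Local Notation RM := (measurableTypeR R).
Local Notation tau := (2 * sigma).
Local Notation b := (2 * k).
Local Notation c i := (4 * sigma * k * i.+1%:R + gamma).
Variables (m : 'I_L -> probability RM R) (mu : probability S R).
Hypothesis m1 : forall i, m i `[0, +oo[%classic = 1%E.
Hypothesis muE : is_product_measure mu m.
Hypothesis m_ibp : forall (i : 'I_L) (phi dphi F : R -> R) (M N : R),
  (forall y : R, is_derive y 1 phi (dphi y)) -> continuous dphi ->
  (forall y, M < y -> phi y = 0) ->
  measurable_fun setT F -> (forall y, `|F y| <= N) ->
  (forall y, 0 <= y -> F y = alpha tau y * dphi y + logd tau b (c i) y * phi y) ->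
  (\int[m i]_y (F y)%:E = 0)%E.

Lemma C1_grad_diff (i j : 'I_L) (F : 'rV[R]_L -> R) : smooth F -> C1 (grad_diff i j F).
Proof. by move=> sF; apply: C1B; apply: smooth_C1; exact: smooth_partial. Qed.

(** A pointwise identity, written so that the two summands are exactly the integrands already known
    to have null integral. All second-order terms sit in the partial derivatives of V. *)
Lemma abep_bond_antisym (i j : 'I_L) (F G : 'rV[R]_L -> R) (x : 'rV[R]_L) :
  j = i.+1 :> nat -> smooth F -> smooth G ->
  let V x := G x * grad_diff i j F x - F x * grad_diff i j G x in
  G x * abep_bond sigma k i j F x - F x * abep_bond sigma k i j G x =
  (4 * sigma ^+ 2)^-1 *
    ((expR (tau * x ord0 j) - 1) *
      (alpha tau (x ord0 i) * partial i V x + logd tau b (c i) (x ord0 i) * V x)) +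
  - (4 * sigma ^+ 2)^-1 *
    (alpha tau (x ord0 i) *
      ((expR (tau * x ord0 j) - 1) * partial j V x +
       (b * tau - (c j - tau) * (expR (tau * x ord0 j) - 1)) * V x)).
Proof.
move=> ji sF sG V.
have CF := smooth_C1 sF; have CG := smooth_C1 sG.
have CdF := C1_grad_diff i j sF; have CdG := C1_grad_diff i j sG.
have pV l : partial l V x = G x * partial l (grad_diff i j F) x +
    grad_diff i j F x * partial l G x - (F x * partial l (grad_diff i j G) x +
    grad_diff i j G x * partial l F x).
  by rewrite /V (partialB l (C1M CG CdF) (C1M CF CdG)) (partialM l CG CdF) (partialM l CF CdG).
rewrite !pV /V /abep_bond /logd /alpha ji.
have -> : grad_diff i j (grad_diff i j F) x =
    partial i (grad_diff i j F) x - partial j (grad_diff i j F) x by [].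
have -> : grad_diff i j (grad_diff i j G) x =
    partial i (grad_diff i j G) x - partial j (grad_diff i j G) x by [].
set A1 := partial i (grad_diff i j F) x; set A2 := partial j (grad_diff i j F) x.
set B1 := partial i (grad_diff i j G) x; set B2 := partial j (grad_diff i j G) x.
have -> : grad_diff i j F x = partial i F x - partial j F x by [].
have -> : grad_diff i j G x = partial i G x - partial j G x by [].
set f1 := partial i F x; set f2 := partial j F x.
set g1 := partial i G x; set g2 := partial j G x.
set u := expR (- _); set v := expR _.
(* Exposes c_j = c_i + 4 sigma k, the relation that makes the drift terms agree. *)
rewrite -[i.+2%:R]natr1.
by field; rewrite gt_eqF.
Qed.

Lemma abep_symmetric (F G : 'rV[R]_L -> R) : test_function F -> test_function G ->
  null_integral mu (fun x : S => G (row_of x) * abep_generator sigma k F (row_of x) -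
    F (row_of x) * abep_generator sigma k G (row_of x)).
Proof.
move=> [sF [KF cKF F0]] [sG [KG cKG G0]].
have [MF [MF0 HF]] := compact_state_bounded cKF.
have [MG [MG0 HG]] := compact_state_bounded cKG.
pose M := Num.max MF MG.
have M0 : 0 <= M by rewrite le_max MF0.
have FM (x : S) l : M < row_of x ord0 l -> F (row_of x) = 0.
  rewrite gt_max => /andP[h _]; apply: F0 => /HF/(_ l).
  by rewrite leNgt h.
have GM (x : S) l : M < row_of x ord0 l -> G (row_of x) = 0.
  rewrite gt_max => /andP[_ h]; apply: G0 => /HG/(_ l).
  by rewrite leNgt h.
rewrite /abep_generator.
under eq_fun do rewrite !mulr_sumr -sumrB.
apply: null_integral_sum => i _.
under eq_fun do rewrite !mulr_sumr -sumrB.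
apply: null_integral_sum => j /eqP ji.
under eq_fun do rewrite (abep_bond_antisym _ ji sF sG).
have ij : i != j by rewrite -val_eqE/= ji ltn_eqF.
have CV : C1 (fun x => G x * grad_diff i j F x - F x * grad_diff i j G x).
  by apply: C1B; apply: C1M; do ?exact: smooth_C1; exact: C1_grad_diff.
have V0 (x : S) l : M < row_of x ord0 l -> G (row_of x) * grad_diff i j F (row_of x) -
    F (row_of x) * grad_diff i j G (row_of x) = 0.
  by move=> xl; rewrite (FM x l)// (GM x l)// !mul0r subr0.
apply: null_integralD; apply: null_integralZ.
  exact: (null_integral_bond_l m1 muE m_ibp CV M0 V0 ij).
exact: (null_integral_bond_r m1 muE m_ibp CV M0 V0 ij).
Qed.

End abep_symmetry.

(** * Symmetry of the semigroup *)

Section bounded_measurable.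
Context {R : realType} {L : nat}.
Local Notation S := (state R L).
Implicit Types f g : S -> R.

(** A class stable under the algebra used below and integrable for every probability measure, so it
    serves both for [mu] and for the kernels [P t x]. *)
Definition bdm f := measurable_fun setT f /\ exists N, forall x, `|f x| <= N.

Lemma bdmB f g : bdm f -> bdm g -> bdm (fun x => f x - g x).
Proof.
move=> [mf [N fN]] [mg [M gM]]; split; first exact: measurable_funB.
exists (N + M) => x.
by rewrite (le_trans (ler_normB _ _))// lerD.
Qed.

Lemma bdmD f g : bdm f -> bdm g -> bdm (fun x => f x + g x).
Proof.
move=> [mf [N fN]] [mg [M gM]]; split; first exact: measurable_funD.
exists (N + M) => x.
by rewrite (le_trans (ler_normD _ _))// lerD.
Qed.

Lemma bdmM f g : bdm f -> bdm g -> bdm (fun x => f x * g x).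
Proof.
move=> [mf [N fN]] [mg [M gM]]; split; first exact: measurable_funM.
by exists (N * M) => x; rewrite normrM ler_pM.
Qed.

Lemma bdm_cst (a : R) : bdm (fun=> a).
Proof. by split; [exact: measurable_cst|exists `|a|]. Qed.

Lemma bdmZ a f : bdm f -> bdm (fun x => a * f x).
Proof. by apply: bdmM; exact: bdm_cst. Qed.

Lemma C0_bdm f : C0 f -> bdm f.
Proof.
move=> [cf f0]; split; first exact: continuous_measurable_state.
have [K cK fK] := f0 1 ltr01.
have /compact_bounded[B [_ HB]] : compact (f @` K).
  by apply: continuous_compact => //; exact: continuous_subspaceT.
exists (`|B| + 1) => x; have [xK|/fK/ltW fx] := pselect (K x).
  apply: HB; first by rewrite (le_lt_trans (ler_norm _))// ltrDl.
  by exists x.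
by rewrite (le_trans fx)// lerDr.
Qed.

Variable Q : {measure set S -> \bar R}.
Hypothesis Q1 : Q setT = 1%E.

Lemma bdm_integrable f : bdm f -> Q.-integrable setT (EFin \o f).
Proof. by move=> [mf fN]; apply: integrable_bounded => //; rewrite Q1 ltry. Qed.

Lemma bdm_EFin f : bdm f -> (\int[Q]_x f x)%:E = (\int[Q]_x (f x)%:E)%E.
Proof. by move=> /bdm_integrable fi; rewrite fineK//; exact: integrable_fin_num. Qed.

Lemma meanB f g : bdm f -> bdm g ->
  \int[Q]_x (f x - g x) = \int[Q]_x f x - \int[Q]_x g x.
Proof. by move=> bf bg; rewrite RintegralB//; exact: bdm_integrable. Qed.

Lemma meanD f g : bdm f -> bdm g ->
  \int[Q]_x (f x + g x) = \int[Q]_x f x + \int[Q]_x g x.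
Proof. by move=> bf bg; rewrite RintegralD//; exact: bdm_integrable. Qed.

Lemma meanZ a f : bdm f -> \int[Q]_x (a * f x) = a * \int[Q]_x f x.
Proof. by move=> bf; rewrite RintegralZl//; exact: bdm_integrable. Qed.

Lemma mean_cst (a : R) : \int[Q]_x a = a.
Proof. by rewrite Rintegral_cst// Q1 mulr1. Qed.

Lemma mean_le f e : bdm f -> (forall x, `|f x| <= e) -> `|\int[Q]_x f x| <= e.
Proof.
move=> bf fe; rewrite (le_trans (le_normr_Rintegral _ (bdm_integrable bf)))//.
rewrite -[leRHS]mean_cst; apply: le_Rintegral => //.
- apply: bdm_integrable; have [mf [N fN]] := bf; split.
    exact: measurableT_comp.
  by exists N => x; rewrite normr_id.
- by apply: bdm_integrable; exact: bdm_cst.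
Qed.

(** Subtracting h times the symmetry relation, which integrates to 0, leaves (ah - a - h a') b - a
    (bh - b - h b'): first-order errors multiplied by bounded functions. *)
Lemma mean_exchange (a a' ah b b' bh : S -> R) (h p q N M : R) :
  bdm a -> bdm a' -> bdm ah -> bdm b -> bdm b' -> bdm bh ->
  \int[Q]_x (a' x * b x) = \int[Q]_x (a x * b' x) ->
  (forall x, `|ah x - a x - h * a' x| <= p) ->
  (forall x, `|bh x - b x - h * b' x| <= q) ->
  (forall x, `|a x| <= N) -> (forall x, `|b x| <= M) ->
  `|\int[Q]_x (ah x * b x) - \int[Q]_x (a x * bh x)| <= p * M + N * q.
Proof.
move=> ba ba' bah bb bb' bbh symE hp hq aN bM.
have b1 := bdmM ba' bb; have b2 := bdmM ba bb'.
have b3 := bdmM bah bb; have b4 := bdmM ba bbh.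
have b5 := bdmZ h (bdmB b1 b2).
have sym0 : \int[Q]_x (h * (a' x * b x - a x * b' x)) = 0.
  by rewrite (meanZ _ (bdmB b1 b2)) (meanB b1 b2) symE subrr mulr0.
have -> : \int[Q]_x (ah x * b x) - \int[Q]_x (a x * bh x) =
    \int[Q]_x (ah x * b x - a x * bh x - h * (a' x * b x - a x * b' x)).
  by rewrite (meanB (bdmB b3 b4) b5) sym0 subr0 (meanB b3 b4).
apply: (mean_le (bdmB (bdmB b3 b4) b5)) => x.
rewrite (_ : _ - _ = (ah x - a x - h * a' x) * b x - a x * (bh x - b x - h * b' x));
  last by ring.
apply: (le_trans (ler_normB _ _)); rewrite !normrM.
by apply: lerD; apply: ler_pM.
Qed.

Lemma mean_cvg (f_ : nat -> S -> R) f (N : R) :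
  (forall n, measurable_fun setT (f_ n)) -> measurable_fun setT f ->
  (forall n x, `|f_ n x| <= N) ->
  (forall x, f_ n x @[n --> \oo] --> f x) ->
  (\int[Q]_x f_ n x) @[n --> \oo] --> \int[Q]_x f x.
Proof.
move=> mf_ mf fN fcvg.
have [] := @dominated_convergence _ S R Q setT measurableT
  (fun n x => (f_ n x)%:E) (EFin \o f) (cst N%:E).
- by move=> n; exact/measurable_EFinP.
- exact/measurable_EFinP.
- by apply: aeW => x _; apply: cvg_EFin => //; [near=> n|exact: fcvg].
- by apply: (bdm_integrable (bdm_cst N)).
- by apply: aeW => x n _; rewrite /= lee_fin.
move=> _ _ h.
have -> : \int[Q]_x f x = fine (\int[Q]_x (f x)%:E)%E by [].
apply: fine_cvg; rewrite fineK//.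
apply: integrable_fin_num => //; apply: bdm_integrable; split => //; exists N => x.
have : `|f_ n x| @[n --> \oo] --> `|f x| by exact: cvg_norm.
by move=> /cvgr_to_le; apply; apply: nearW => n; exact: fN.
Unshelve. all: end_near. Qed.

End bounded_measurable.
(** Telescoping over equal steps of length below [d]. Only forward increments are estimated, as
    suits a generator defined by a right-hand limit. *)
Lemma eq_small_increments {R : realType} (u : R -> R) (t C : R) :
  0 <= t -> 0 <= C ->
  (forall e, 0 < e -> exists2 d : R, 0 < d & forall h s, 0 < h -> h < d ->
    0 <= s -> s + h <= t -> `|u (s + h) - u s| <= e * h * C) ->
  u t = u 0.
Proof.
rewrite le_eqVlt => /predU1P[<-//|t0] C0 step.
apply/eqP; rewrite -subr_eq0 -normr_le0; apply/ler_addgt0Pr => e e0; rewrite add0r.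
(* The telescoped error e t C / D is at most e; adding 1 keeps the divisor positive when C = 0. *)
pose D := t * C + 1.
have D0 : 0 < D by rewrite ltr_wpDl// mulr_ge0// ltW.
have [d d0 Hd] := step _ (divr_gt0 e0 D0).
pose n := Num.truncn (t / d).
pose h := t / n.+1%:R.
have h0 : 0 < h by rewrite divr_gt0.
have hd : h < d.
  rewrite ltr_pdivrMr// mulrC -ltr_pdivrMr//.
  by have /andP[] := truncn_itv (ltW (divr_gt0 t0 d0)).
have hn : n.+1%:R * h = t by rewrite mulrC divfK.
have tele j : (j <= n.+1)%N ->
    `|u (j%:R * h) - u 0| <= j%:R * (e / D * h * C).
  elim: j => [|j ih] jn; first by rewrite !mul0r subrr normr0.
  have jh : j%:R * h + h = j.+1%:R * h by rewrite -[in RHS]natr1 mulrDl mul1r.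
  rewrite -jh -[in leRHS]natr1 mulrDl mul1r.
  rewrite (le_trans (ler_distD (u (j%:R * h)) _ _))// addrC lerD//.
    by apply: ih; exact: ltnW.
  apply: Hd => //; first by rewrite mulr_ge0// ltW.
  by rewrite jh -hn ler_pM2r// ler_nat.
have := tele n.+1 (leqnn _); rewrite hn => /le_trans; apply.
have -> : n.+1%:R * (e / D * h * C) = e / D * ((n.+1%:R * h) * C) by ring.
by rewrite hn mulrAC ler_pdivrMr// ler_pM2l// lerDl.
Qed.

Section semigroup.
Context {R : realType} {L : nat}.
Local Notation S := (state R L).
Implicit Types f g : S -> R.
Variable P : R -> R.-pker S ~> S.
Hypothesis msP : markov_semigroup P.
Hypothesis fP : feller P.

Let P1 t x : P t x setT = 1%E. Proof. exact: prob_kernel. Qed.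

(** The relation on sets says that [P (s + t) x] is the composed kernel, and integration against a
    composed kernel is iterated integration. *)
Lemma chapman_kolmogorov_ge0 (f : S -> \bar R) s t x : 0 <= s -> 0 <= t ->
  (forall z, 0 <= f z)%E -> measurable_fun setT f ->
  (\int[P (s + t) x]_z f z = \int[P s x]_y \int[P t y]_z f z)%E.
Proof.
move=> s0 t0 f0 mf.
have /= := @integral_kcomp _ _ _ _ _ _ R (P s) (kernel.kernel_snd (P t)) x f f0 mf.
move=> <-.
have /= -> // := @eq_measure_integral _ S R setT (P (s + t) x)
  [the {measure set S -> \bar R} of kcomp (P s) (kernel.kernel_snd (P t)) x] f.
by move=> A mA _; rewrite msP.2.
Qed.

Lemma semigroup_opD s t f : 0 <= s -> 0 <= t -> C0 f ->
  semigroup_op P (s + t) f = semigroup_op P s (semigroup_op P t f).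
Proof.
move=> s0 t0 f0; apply/funext => x.
have bf := C0_bdm f0; have [mf [N fN]] := bf.
have bPf := C0_bdm (fP.1 _ _ t0 f0).
(* Adding the bound N makes the function nonnegative; as every kernel has mass 1, the shift cancels
   at the end. *)
have bg : bdm (fun z => f z + N) by apply: bdmD => //; exact: bdm_cst.
have g0 z : 0 <= f z + N.
  by have := fN z; rewrite ler_norml => /andP[h _]; rewrite -lerBlDr sub0r.
have key : \int[P (s + t) x]_z (f z + N) =
    \int[P s x]_y (semigroup_op P t f y + N).
  apply: EFin_inj; rewrite !bdm_EFin//; last by apply: bdmD => //; exact: bdm_cst.
  rewrite (chapman_kolmogorov_ge0 _ (t := t))//; last first.
    by apply/measurable_EFinP; exact: bg.1.
  apply: eq_integral => y _; rewrite -bdm_EFin//.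
  by rewrite meanD// ?mean_cst//; exact: bdm_cst.
by move: key; rewrite !meanD ?mean_cst//; [move/addIr|exact: bdm_cst|exact: bdm_cst].
Qed.

Lemma semigroup_op0 f : C0 f -> semigroup_op P 0 f = f.
Proof.
move=> f0; apply/funext => x; rewrite /semigroup_op /Rintegral.
have /= <- := @eq_measure_integral _ S R setT (P 0 x) (\d_x)%E (EFin \o f).
  rewrite integral_dirac//; last by apply/measurable_EFinP; exact: (C0_bdm f0).1.
  by rewrite diracE in_setT mul1e.
by move=> A mA _; rewrite msP.1.
Qed.

(** [P s] does not increase the sup norm, so applying it to the first-order expansion at time 0
    gives an error that is uniform in [s]. *)
Lemma generator_step f f' : generator P f f' -> forall e : R, 0 < e ->
  exists2 d : R, 0 < d & forall h s x, 0 < h -> h < d -> 0 <= s ->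
    `|semigroup_op P (h + s) f x - semigroup_op P s f x
      - h * semigroup_op P s f' x| <= e * h.
Proof.
move=> [f0 f'0 gen] e e0.
have [d /= d0 Hd] := gen e e0.
exists d => // h s x h0 hd s0.
have bf := C0_bdm f0; have bf' := C0_bdm f'0.
have bPf := C0_bdm (fP.1 _ _ (ltW h0) f0).
rewrite [h + s]addrC semigroup_opD ?(ltW h0)//.
have -> : semigroup_op P s (semigroup_op P h f) x - semigroup_op P s f x
    - h * semigroup_op P s f' x =
    \int[P s x]_y (semigroup_op P h f y - f y - h * f' y).
  by rewrite meanB ?meanB ?meanZ//; [exact: bdmB|exact: bdmZ].
apply: mean_le => //.
  by apply: bdmB; [exact: bdmB|exact: bdmZ].
move=> y; have hb : ball_ Num.norm 0 d h by rewrite /ball_/= sub0r normrN gtr0_norm.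
have /ltW := Hd h hb h0 y.
rewrite -(ler_pM2r h0) => H; apply: (le_trans _ H).
rewrite -[X in _ <= _ * X](gtr0_norm h0) -normrM.
by rewrite le_eqVlt; apply/orP; left; apply/eqP; congr (`|_|); field; rewrite gt_eqF.
Qed.

Variable mu : probability S R.
Hypothesis gen_sym : forall f f' g g', generator P f f' -> generator P g g' ->
  \int[mu]_x (f' x * g x) = \int[mu]_x (f x * g' x).

(** The domain is invariant and the generator commutes with the semigroup, so symmetry of the
    generator is available along the whole orbit. *)
Lemma generator_semigroup f f' s : generator P f f' -> 0 <= s ->
  generator P (semigroup_op P s f) (semigroup_op P s f').
Proof.
move=> gf s0; have [f0 f'0 _] := gf; split; [exact: fP.1|exact: fP.1|].
(* Half of [e] turns the weak inequality of [generator_step] into a strict one. *)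
move=> e e0; have e20 : 0 < e / 2 by rewrite divr_gt0.
have [d d0 Hd] := generator_step gf e20.
exists d => // h /=; rewrite sub0r normrN => hd h0 x.
rewrite gtr0_norm// in hd.
have := Hd h s x h0 hd s0; rewrite semigroup_opD ?(ltW h0)// => H.
rewrite (_ : _ - _ = h^-1 * (semigroup_op P h (semigroup_op P s f) x -
    semigroup_op P s f x - h * semigroup_op P s f' x)); last first.
  by field; rewrite gt_eqF.
rewrite normrM gtr0_norm ?invr_gt0// mulrC ltr_pdivrMr//.
by rewrite (le_lt_trans H)// ltr_pM2r// ltr_pdivrMr// ltr_pMr// ltr1n.
Qed.

Let u (t : R) f g (s : R) :=
  \int[mu]_x (semigroup_op P s f x * semigroup_op P (t - s) g x).

Lemma semigroup_symmetric f f' g g' t : generator P f f' -> generator P g g' ->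
  0 <= t -> \int[mu]_x (semigroup_op P t f x * g x) =
            \int[mu]_x (f x * semigroup_op P t g x).
Proof.
move=> gf gg t0; have [f0 f'0 _] := gf; have [g0 g'0 _] := gg.
have [_ [Nf fN]] := C0_bdm f0; have [_ [Ng gN]] := C0_bdm g0.
have bP s h : 0 <= s -> C0 h -> bdm (semigroup_op P s h).
  by move=> s0 h0; apply: C0_bdm; exact: fP.1.
have PN s h N x : 0 <= s -> C0 h -> (forall y, `|h y| <= N) ->
    `|semigroup_op P s h x| <= N.
  by move=> s0 h0 hN; apply: mean_le => //; exact: C0_bdm.
have step e : 0 < e -> exists2 d : R, 0 < d & forall h s, 0 < h -> h < d ->
    0 <= s -> s + h <= t -> `|u t f g (s + h) - u t f g s| <= e * h * (Nf + Ng).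
  move=> e0.
  have [d1 d10 H1] := generator_step gf e0.
  have [d2 d20 H2] := generator_step gg e0.
  exists (Num.min d1 d2); first by rewrite lt_min d10.
  move=> h s h0; rewrite lt_min => /andP[hd1 hd2] s0 sht.
  (* Both factors are expanded from the earlier of their two times, [s] and [r], so that passing
     from s to s + h compares two forward increments. *)
  pose r := t - (s + h); have r0 : 0 <= r by rewrite subr_ge0.
  have hs0 : 0 <= h + s by rewrite addr_ge0// ltW.
  have hr0 : 0 <= h + r by rewrite addr_ge0// ltW.
  have tsE : t - s = h + r by rewrite /r; ring.
  have symE := gen_sym (generator_semigroup gf s0) (generator_semigroup gg r0).
  rewrite /u -/r tsE [s + h]addrC.
  rewrite (_ : e * h * (Nf + Ng) = (e * h) * Ng + Nf * (e * h)); last by ring.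
  apply: (@mean_exchange _ _ _ (probability_setT mu) _ _ _ _ _ _ h _ _ _ _
    (bP _ _ s0 f0) (bP _ _ s0 f'0) (bP _ _ hs0 f0)
    (bP _ _ r0 g0) (bP _ _ r0 g'0) (bP _ _ hr0 g0) symE) => x.
  - exact: H1.
  - exact: H2.
  - exact: PN.
  - exact: PN.
have uE0 : u t f g 0 = \int[mu]_x (f x * semigroup_op P t g x).
  by rewrite /u (semigroup_op0 f0) subr0.
have uEt : u t f g t = \int[mu]_x (semigroup_op P t f x * g x).
  by rewrite /u subrr (semigroup_op0 g0).
rewrite -uE0 -uEt; apply: eq_small_increments t0 _ step.
by apply: addr_ge0; [exact: le_trans (fN point)|exact: le_trans (gN point)].
Qed.

End semigroup.

(** * Reversibility *)

Section mixture.
Context d d' (T : measurableType d) (T' : measurableType d') (R : realType).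
Variables (mu : {measure set T -> \bar R}) (k : R.-pker T ~> T') (D : set T).
Hypothesis mD : measurable D.
Local Open Scope ereal_scope.

(** For k = P_t, the law at time t of the process started from [mu] restricted to [D]. *)
Definition mixture (B : set T') : \bar R := \int[mu]_(x in D) k x B.

Let mixture0 : mixture set0 = 0.
Proof. by rewrite /mixture (eq_integral (cst 0)) ?integral0// => x _; rewrite measure0. Qed.

Let mixture_ge0 B : 0 <= mixture B. Proof. exact: integral_ge0. Qed.

Let mixture_sigma_additive : semi_sigma_additive mixture.
Proof.
move=> F mF tF mUF; rewrite [X in _ --> X](_ : _ =
    \int[mu]_(x in D) (\sum_(n <oo) k x (F n))); last first.
  apply: eq_integral => x _.
  by apply/esym/cvg_lim => //; exact/measure_semi_sigma_additive.
apply/cvg_closeP; split.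
  by apply: is_cvg_nneseries => n _ _; exact: integral_ge0.
rewrite closeE// integral_nneseries// => n.
by apply: measurable_funTS; exact: measurable_kernel.
Qed.

HB.instance Definition _ := isMeasure.Build _ _ _
  mixture mixture0 mixture_ge0 mixture_sigma_additive.

Lemma exists_mixture : exists nu : {measure set T' -> \bar R},
  forall B, nu B = \int[mu]_(x in D) k x B.
Proof. by exists mixture. Qed.

End mixture.

Section reversibility.
Context {R : realType} {L : nat}.
Local Notation S := (state R L).
Variables (sigma k : R) (P : R -> R.-pker S ~> S) (mu : probability S R).
Hypothesis hP : is_abep sigma k P.
Hypothesis sym : forall F G : 'rV[R]_L -> R, test_function F -> test_function G ->
  null_integral mu (fun x : S => G (row_of x) * abep_generator sigma k F (row_of x) -
    F (row_of x) * abep_generator sigma k G (row_of x)).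

Let muT : mu setT = 1%E. Proof. exact: probability_setT. Qed.

Lemma generator_symmetric f f' g g' : generator P f f' -> generator P g g' ->
  \int[mu]_x (f' x * g x) = \int[mu]_x (f x * g' x).
Proof.
case: hP => _ _ test core gf gg.
have [f0 f'0 _] := gf; have [g0 g'0 _] := gg.
have bf := C0_bdm f0; have bf' := C0_bdm f'0.
have bg := C0_bdm g0; have bg' := C0_bdm g'0.
have [_ [Nf fN]] := bf; have [_ [Nf' f'N]] := bf'.
have [_ [Ng gN]] := bg; have [_ [Ng' g'N]] := bg'.
have nneg (h : S -> R) N : (forall x, `|h x| <= N) -> 0 <= N.
  by move=> hN; exact: le_trans (hN point).
have Nf0 := nneg _ _ fN; have Nf'0 := nneg _ _ f'N.
have Ng0 := nneg _ _ gN; have Ng'0 := nneg _ _ g'N.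
apply/eqP; rewrite -subr_eq0 -normr_le0; apply/ler_addgt0Pr => e e0; rewrite add0r.
(* The four terms bound the errors from replacing f', g, g' and f by their approximations; each + 1
   comes from d <= 1, used to bound the approximants themselves. *)
pose C := Ng + (Nf' + 1) + (Ng' + (Nf + 1)).
have C0' : 0 < C by rewrite /C; lra.
pose d := Num.min (e / C) 1.
have d0 : 0 < d by rewrite lt_min divr_gt0//= ltr01.
have d1 : d <= 1 by rewrite ge_min lexx orbT.
have dC : d * C <= e by rewrite -ler_pdivlMr// ge_min lexx.
have [F [tF fF f'F]] := core _ _ gf _ d0.
have [G [tG gG g'G]] := core _ _ gg _ d0.
have [F0 AF0 _] := test _ tF; have [G0 AG0 _] := test _ tG.
have bF := C0_bdm F0; have bAF := C0_bdm AF0.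
have bG := C0_bdm G0; have bAG := C0_bdm AG0.
have s0 := (sym tF tG).2.
have s0' : \int[mu]_x (G (row_of x) * abep_generator sigma k F (row_of x) -
    F (row_of x) * abep_generator sigma k G (row_of x)) = 0.
  by rewrite /Rintegral s0.
have -> : \int[mu]_x (f' x * g x) - \int[mu]_x (f x * g' x) =
    \int[mu]_x (f' x * g x - f x * g' x -
      (G (row_of x) * abep_generator sigma k F (row_of x) -
       F (row_of x) * abep_generator sigma k G (row_of x))).
  have bGF : bdm (fun x : S => G (row_of x) * abep_generator sigma k F (row_of x) -
      F (row_of x) * abep_generator sigma k G (row_of x)).
    by apply: bdmB; [exact: (bdmM bG bAF)|exact: (bdmM bF bAG)].
  by rewrite meanB ?s0' ?subr0 ?meanB//; do ?[apply: bdmB]; exact: bdmM.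
apply: mean_le => //.
  apply: bdmB; first by apply: bdmB; exact: bdmM.
  by apply: bdmB; [exact: (bdmM bG bAF)|exact: (bdmM bF bAG)].
move=> x.
set Fx := F (row_of x); set Gx := G (row_of x).
set AF := abep_generator _ _ F _; set AG := abep_generator _ _ G _.
have hF : `|f x - Fx| <= d by apply/ltW/fF.
have hG : `|g x - Gx| <= d by apply/ltW/gG.
have hAF : `|f' x - AF| <= d by apply/ltW/f'F.
have hAG : `|g' x - AG| <= d by apply/ltW/g'G.
have nAF : `|AF| <= Nf' + 1.
  rewrite (_ : AF = f' x - (f' x - AF)); last by ring.
  by rewrite (le_trans (ler_normB _ _))// lerD// (le_trans hAF).
have nF : `|Fx| <= Nf + 1.
  rewrite (_ : Fx = f x - (f x - Fx)); last by ring.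
  by rewrite (le_trans (ler_normB _ _))// lerD// (le_trans hF).
rewrite (_ : _ - _ = ((f' x - AF) * g x + AF * (g x - Gx)) -
    ((f x - Fx) * g' x + Fx * (g' x - AG))); last by ring.
apply: (le_trans _ dC).
have prod_le (u v p q : R) : `|u| <= p -> `|v| <= q -> `|u * v| <= p * q.
  by move=> up vq; rewrite normrM ler_pM.
have := prod_le _ _ _ _ hAF (gN x); have := prod_le _ _ _ _ nAF hG.
have := prod_le _ _ _ _ hF (g'N x); have := prod_le _ _ _ _ nF hAG.
have := ler_normB ((f' x - AF) * g x + AF * (g x - Gx)) ((f x - Fx) * g' x + Fx * (g' x - AG)).
have := ler_normD ((f' x - AF) * g x) (AF * (g x - Gx)).
have := ler_normD ((f x - Fx) * g' x) (Fx * (g' x - AG)).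
rewrite /C; lra.
Qed.

Let bump_state (a b : 'I_L -> R) n (x : S) := box_bump a b n (row_of x).

Lemma bump_state_cvg a b x :
  bump_state a b n x @[n --> \oo] --> (\1_(obox a b) x : R).
Proof.
rewrite indicE; case: (boolP (x \in obox a b)) => [/set_mem xab|xab].
  exact: bump_cvg.
have /existsNP[l /negP xl] : ~ obox a b x by move=> h; rewrite mem_set in xab.
rewrite (_ : (fun n => _) = cst 0); first exact: cvg_cst.
by apply/funext => n; rewrite /bump_state (bump_eq0 _ xl).
Qed.

(** Bounded convergence is used twice as the bumps increase to the indicators: under the kernels
    [P t x], then under [mu]. *)
Lemma reversible_obox t (a b a' b' : 'I_L -> R) : 0 <= t ->
  (\int[mu]_(x in obox a b) P t x (obox a' b') =
   \int[mu]_(x in obox a' b') P t x (obox a b))%E.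
Proof.
move=> t0; case: (hP) => msP fP test _.
have P1 x : P t x setT = 1%E by exact: prob_kernel.
have gen c d n := test _ (bump_test_function c d n).
have C0b c d n : C0 (bump_state c d n) by have [] := gen c d n.
have le1 c d n x : `|bump_state c d n x| <= 1.
  by rewrite ger0_norm ?bump_ge0// bump_le1.
have mob c d : measurable (obox c d : set S) by exact: measurable_obox.
have Plim c d x : semigroup_op P t (bump_state c d n) x @[n --> \oo] -->
    fine (P t x (obox c d)).
  rewrite (_ : fine _ = \int[P t x]_y \1_(obox c d) y); last first.
    by rewrite /Rintegral integral_indic// setIT.
  apply: (mean_cvg (P1 x) (N := 1)) => //.
  - by move=> n; exact: (C0_bdm (C0b c d n)).1.
  - by move=> y; exact: bump_state_cvg.
have Pb c d n x : `|semigroup_op P t (bump_state c d n) x| <= 1.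
  by apply: mean_le => //; exact: C0_bdm.
have mPb c d n : measurable_fun setT (semigroup_op P t (bump_state c d n)).
  by apply: (C0_bdm _).1; exact: fP.1.
have mfP c d : measurable_fun setT (fun x => fine (P t x (obox c d))).
  by apply: measurableT_comp => //; exact: measurable_kernel.
have lim1 : \int[mu]_x (semigroup_op P t (bump_state a b n) x * bump_state a' b' n x)
    @[n --> \oo] --> \int[mu]_x (fine (P t x (obox a b)) * \1_(obox a' b') x).
  apply: (mean_cvg muT (N := 1)).
  - by move=> n; apply: measurable_funM => //; exact: (C0_bdm (C0b _ _ n)).1.
  - by apply: measurable_funM.
  - by move=> n x; rewrite normrM mulr_ile1.
  - by move=> x; apply: cvgM; [exact: Plim|exact: bump_state_cvg].
have lim2 : \int[mu]_x (bump_state a b n x * semigroup_op P t (bump_state a' b' n) x)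
    @[n --> \oo] --> \int[mu]_x (\1_(obox a b) x * fine (P t x (obox a' b'))).
  apply: (mean_cvg muT (N := 1)).
  - by move=> n; apply: measurable_funM => //; exact: (C0_bdm (C0b _ _ n)).1.
  - by apply: measurable_funM.
  - by move=> n x; rewrite normrM mulr_ile1.
  - by move=> x; apply: cvgM; [exact: bump_state_cvg|exact: Plim].
have E : \int[mu]_x (\1_(obox a b) x * fine (P t x (obox a' b'))) =
    \int[mu]_x (fine (P t x (obox a b)) * \1_(obox a' b') x).
  have eqs : (fun n => \int[mu]_x (bump_state a b n x *
        semigroup_op P t (bump_state a' b' n) x)) =
      (fun n => \int[mu]_x (semigroup_op P t (bump_state a b n) x *
        bump_state a' b' n x)).
    apply/funext => n; apply/esym.
    exact: (semigroup_symmetric msP fP generator_symmetric (gen a b n) (gen a' b' n) t0).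
  by move: lim2; rewrite eqs => lim2; exact: (cvg_unique _ lim2 lim1).
have Ple1 c d x : (P t x (obox c d) <= 1)%E.
  rewrite -(P1 x); apply: le_measure; rewrite ?inE//.
have Pfin c d x : P t x (obox c d) \is a fin_num.
  by rewrite ge0_fin_numE// (le_lt_trans (Ple1 c d x))// ltry.
have toR c d c' d' : (\int[mu]_(x in obox c d) P t x (obox c' d') =
    (\int[mu]_x (\1_(obox c d) x * fine (P t x (obox c' d'))))%:E)%E.
  have bI : bdm (fun x => \1_(obox c d) x * fine (P t x (obox c' d'))).
    split; first by apply: measurable_funM.
    exists 1 => x; rewrite normrM mulr_ile1//.
      by rewrite indicE; case: (_ \in _); rewrite ?normr1 ?normr0.
    by rewrite ger0_norm ?fine_ge0// -lee_fin fineK.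
  rewrite (bdm_EFin muT bI) integral_mkcond; apply: eq_integral => x _.
  rewrite patchE indicE; case: ifP => _; rewrite ?mul1r ?mul0r//.
  by rewrite fineK.
rewrite !toR E; congr EFin; apply: eq_Rintegral => x _; exact: mulrC.
Qed.

(** With one set fixed, each side is a finite measure in the other: a mixture of kernels on one
    side, a density on the other. Uniqueness then frees the two sets one after the other. *)
Lemma reversible_abep : reversible P mu.
Proof.
move=> t t0.
have [msP _ _ _] := hP.
have Pm A B : measurable A -> measurable B ->
    (\int[mu]_(x in A) P t x B < +oo)%E.
  move=> mA mB; apply: (@le_lt_trans _ _ (\int[mu]_(x in A) 1)%E).
    apply: ge0_le_integral => //.
    - by apply: measurable_funTS; exact: measurable_kernel.
    - move=> x _; rewrite -(prob_kernel (s := P t) x).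
      by apply: le_measure; rewrite ?inE.
  rewrite integral_cst// mul1e -ge0_fin_numE//.
  exact: fin_num_measure.
have dens B : measurable B -> exists nu : {measure set S -> \bar R},
    forall A, nu A = (\int[mu]_(x in A) P t x B)%E.
  by move=> mB; apply: exists_density_measure => //; exact: measurable_kernel.
have half a b B : measurable B -> (\int[mu]_(x in obox a b) P t x B =
    \int[mu]_(x in B) P t x (obox a b))%E.
  move=> mB; have mab : measurable (obox a b : set S) by exact: measurable_obox.
  have [nu1 nu1E] := exists_mixture mu (P t) mab.
  have [nu2 nu2E] := dens _ mab.
  rewrite -nu1E -nu2E; apply: state_measure_unique => //.
    by rewrite nu1E; exact: Pm.
  by move=> a' b'; rewrite nu1E nu2E reversible_obox.
move=> A B mA mB.
have [nu1 nu1E] := dens _ mB.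
have [nu2 nu2E] := exists_mixture mu (P t) mB.
rewrite -nu1E -nu2E; apply: state_measure_unique => //.
  by rewrite nu1E; exact: Pm.
by move=> a b; rewrite nu1E nu2E half.
Qed.

End reversibility.

Unset Implicit Arguments.

Theorem theorem3p3 (R : realType) (sigma k : R) (hsigma : 0 < sigma)
    (hk : 0 <= k) (L : nat) (hL : (2 <= L)%N)
    (P : R -> R.-pker (state R L) ~> (state R L))
    (hP : is_abep sigma k P)
    (gamma : R) (hgamma : - (4 * sigma * k) < gamma) :
  exists mu : {measure set (state R L) -> \bar R},
    [/\ is_product_measure mu
          (fun i : 'I_L => abep_marginal sigma k gamma i.+1),
        (forall i : 'I_L,
           abep_Z sigma k gamma i.+1 =
           (\int[lebesgue_measure]_(x in `[0%R, +oo[)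
              (abep_weight sigma k gamma i.+1 x)%:E)%E),
        (0 < k ->
           (forall i : 'I_L, abep_marginal sigma k gamma i.+1 setT = 1%E) /\
           mu setT = 1%E) &
        reversible P mu].
Proof.
have ZE (i : 'I_L) : abep_Z sigma k gamma i.+1 =
    (\int[lebesgue_measure]_(x in `[0%R, +oo[)
       (abep_weight sigma k gamma i.+1 x)%:E)%E.
  exact: abep_ZE.
move: hk; rewrite le_eqVlt => /predU1P[k0|k0].
  have marg0 (i : nat) (A : set R) : abep_marginal sigma k gamma i.+1 A = 0%E.
    apply: integral0_eq => x _.
    by rewrite /abep_density abep_Z_pinfty// invey mul0e.
  exists mzero; split => [A mA|//||t t0 A B mA mB].
  (* The product has at least one factor, and all factors are 0; the empty product would have been
     1. *)
  - case: L hL A mA {P hP ZE} => // n _ A mA.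
    by rewrite big_ord_recl/= marg0 mul0e.
  - by move=> kpos; move: kpos; rewrite -k0 ltxx.
  - by rewrite !integral_measure_zero.
have /choice[m mP] := fun i : 'I_L => exists_marginal i hsigma hgamma k0.
have m1 i : m i `[0, +oo[%classic = 1%E by have [_ + _] := mP i.
have [mu muE] := exists_product_measure m1.
have m_ibp i := let: And3 _ _ h := mP i in h.
have sym := abep_symmetric hsigma m1 muE m_ibp.
exists mu; split => //.
- move=> A mA; rewrite muE//; apply: eq_bigr => i _.
  by have [h _ _] := mP i; exact: h.
- move=> _; split; last exact: probability_setT.
  by move=> i; have [h _ _] := mP i; rewrite -h//; exact: probability_setT.
- exact: reversible_abep hP sym.
Qed.
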